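(* The decision problem FireFightingInTime is in PSPACE, and therefore the decision problem FireFighting is in PSPACE as well.
   Context: All graphs are finite, simple and undirected. For a graph $G=(V,E)$ and $W\subseteq V$, $N(W)$ is the set of nodes in $V\setminus W$ adjacent to at least one node of $W$. For $m\in\mathbb{N}_{>0}$, an $m$-strategy of length $T$ is a sequence $(F_1,\dots,F_T)$ of subsets of $V$ with $|F_i|\le m$. Its burning sets are $B_0=V$ and $B_t=(B_{t-1}\setminus F_t)\cup N(B_{t-1}\setminus F_t)$ for $t\ge1$, where $F_t=\emptyset$ for $t>T$. The strategy is winning if $B_T=\emptyset$. $\text{ffn}(G)$ is the smallest $m$ admitting a winning $m$-strategy. FireFighting: given $G$ and $m\in\mathbb{N}_{>0}$, decide whether $\text{ffn}(G)\le m$. FireFightingInTime: given $G$, $m\in\mathbb{N}_{>0}$ and $T\in\mathbb{N}_{>0}$ (numbers encoded in binary), decide whether there is a winning $m$-strategy for $G$ of length $T$. *)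

(* Defs.v *)
From HB Require Import structures.
From mathcomp Require Import all_boot.
From mathcomp Require Import boolp.

Set Implicit Arguments.
Unset Strict Implicit.
Unset Printing Implicit Defensive.

Record sgraph := SGraph {
  vertex :> finType;
  adj : rel vertex;
  adj_sym : symmetric adj;
  adj_irr : irreflexive adj
}.

Section Firefighting.
Variable G : sgraph.
Implicit Types (W : {set G}) (F : seq {set G}).

Definition nbhd W : {set G} := [set v | (v \notin W) && [exists w in W, adj w v]].

(* [F] lists F_1, ..., F_T, so F_(t+1) is [nth set0 F t], which is empty once
   t >= T. *)
Fixpoint burning F (t : nat) : {set G} :=
  if t is t'.+1 then
    let U := burning F t' :\: nth set0 F t' in U :|: nbhd U
  else setT.

Definition strategy (m T : nat) F : Prop :=
  size F = T /\ all (fun A : {set G} => #|A| <= m) F.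

Definition winning F : Prop := burning F (size F) = set0.

Definition winnable_in_time (m T : nat) : Prop :=
  exists F, strategy m T F /\ winning F.

Definition winnable (m : nat) : Prop := exists T, winnable_in_time m T.

Lemma winnable_exists : exists m, (0 < m) && `[< winnable m >].
Proof.
exists #|G|.+1; apply/andP; split=> //; apply/asboolP.
exists 1, [:: setT]; split; first by split; rewrite //= cardsT leqnSn.
rewrite /winning /= setDv set0U; apply/setP=> v; rewrite !inE /=.
by apply/existsP=> -[w]; rewrite inE.
Qed.

Definition ffn : nat := ex_minn winnable_exists.

End Firefighting.

Inductive move := MoveLeft | Stay | MoveRight.

(* The machine has [tm_tapes.+1] tapes, infinite in both directions. The tape
   alphabet consists of the blank ([None]), the input alphabet [Sigma] and
   further letters [tm_extra]. A state [q] with [tm_verdict q = Some b] is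
   halting, and accepting exactly when [b] is [true]. *)
Record TM (Sigma : finType) := MkTM {
  tm_state : finType;
  tm_extra : finType;
  tm_tapes : nat;
  tm_start : tm_state;
  tm_verdict : tm_state -> option bool;
  tm_trans : tm_state ->
    {ffun 'I_tm_tapes.+1 -> option (Sigma + tm_extra)} ->
    tm_state * {ffun 'I_tm_tapes.+1 -> option (Sigma + tm_extra) * move}
}.

(* [Tape l a r]: the head scans [a]; [l] and [r] are the letters to its left
   and right, nearest first. All cells not listed are blank and have never been
   visited. *)
Record tape (A : Type) := Tape {
  tape_left : seq (option A);
  tape_head : option A;
  tape_right : seq (option A)
}.

Definition tape_size A (t : tape A) : nat :=
  (size (tape_left t) + size (tape_right t)).+1.

Definition tape_of_word A (w : seq A) : tape A :=
  if w is a :: w' then Tape [::] (Some a) (map Some w')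
  else Tape [::] None [::].

Definition tape_act A (t : tape A) (a : option A * move) : tape A :=
  let: Tape l _ r := t in
  match a.2 with
  | Stay => Tape l a.1 r
  | MoveLeft => Tape (behead l) (head None l) (a.1 :: r)
  | MoveRight => Tape (a.1 :: l) (head None r) (behead r)
  end.

Section Machine.
Variables (Sigma : finType) (M : TM Sigma).

Record config := Config {
  cfg_state : tm_state M;
  cfg_tapes : {ffun 'I_(tm_tapes M).+1 -> tape (Sigma + tm_extra M)}
}.

Definition tm_init (w : seq Sigma) : config :=
  Config (tm_start M)
    [ffun i => tape_of_word (if i == ord0 then map inl w else [::])].

Definition tm_step (c : config) : config :=
  if tm_verdict (cfg_state c) is Some _ then c else
  let: (q, act) :=
    tm_trans (cfg_state c) [ffun i => tape_head (cfg_tapes c i)] in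
  Config q [ffun i => tape_act (cfg_tapes c i) (act i)].

Definition tm_run (w : seq Sigma) (t : nat) : config :=
  iter t tm_step (tm_init w).

(* Cells holding the input are counted as well. *)
Definition cfg_space (c : config) : nat := \sum_i tape_size (cfg_tapes c i).

Definition decides (L : seq Sigma -> Prop) : Prop :=
  forall w, exists t b,
    tm_verdict (cfg_state (tm_run w t)) = Some b /\ (b = true <-> L w).

Definition runs_in_space (s : nat -> nat) : Prop :=
  forall w t, cfg_space (tm_run w t) <= s (size w).

End Machine.

Definition PSPACE (Sigma : finType) (L : seq Sigma -> Prop) : Prop :=
  exists (M : TM Sigma) (c d : nat),
    decides M L /\ runs_in_space M (fun n => c * n ^ d + c).

(* The alphabet {0, 1, #}: [Some b] is the bit [b] and [None] is the separator #. *)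
Definition letter : finType := option bool.

Fixpoint positive_bits (p : BinNums.positive) : seq bool :=
  match p with
  | BinNums.xH => [:: true]
  | BinNums.xO p' => false :: positive_bits p'
  | BinNums.xI p' => true :: positive_bits p'
  end.

(* Binary, least significant bit first, without superfluous zeros. *)
Definition binary (n : nat) : seq bool :=
  if bin_of_nat n is BinNums.Npos p then positive_bits p else [::].

Definition bits (s : seq bool) : seq letter := map Some s.

(* 1^n # followed by the n x n adjacency matrix, row by row. *)
Definition encode_graph (G : sgraph) : seq letter :=
  bits (nseq #|G| true) ++ None ::
  bits [seq adj x y | x <- enum G, y <- enum G].

Definition FireFighting (w : seq letter) : Prop :=
  exists (G : sgraph) (m : nat),
    [/\ 0 < m, w = encode_graph G ++ None :: bits (binary m) & ffn G <= m].

Definition FireFightingInTime (w : seq letter) : Prop :=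
  exists (G : sgraph) (m T : nat),
    [/\ 0 < m, 0 < T,
        w = encode_graph G ++ None :: bits (binary m)
                           ++ None :: bits (binary T)
      & winnable_in_time G m T].

(* Main.v *)
From mathcomp Require Import all_boot.
Require Import Defs.

Set Implicit Arguments.
Unset Strict Implicit.
Unset Printing Implicit Defensive.

(** Write [reach T A B] if some [m]-strategy of length [T], started on the burning
    set [A], ends inside [B]. Burning is monotone, so for a bit [t] one has
    [reach (t + 2 T) A B] iff there are [F] and [C] with [|F| <= m] if [t = 1],
    [reach T A' C] and [reach T C B], where [A'] is the successor of [A] under [F] if
    [t = 1] and [A] otherwise. Unfolding this along the binary digits of the time
    bound gives a quantified Boolean formula with polynomially many variables: at
    each level [F] and [C] are existential and the choice of the half is universal.
    The symmetry and irreflexivity of the input matrix are expressed by universal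
    variables as well. A quantified formula is evaluated in polynomial space by an
    odometer that runs through all assignments and keeps one partial result per
    digit. For FireFighting the bound [2 ^ n - 1], in binary a string of [n] ones,
    suffices, since a shortest play never repeats a burning set.

    The machine is obtained by compiling a while language whose programs act on the
    heads of finitely many tapes and on a finite set of flags. *)

(** * A while language on tapes *)

(** The class is defined by concrete multi-tape machines whose space is counted at every time and on
    every word, so a machine has to be exhibited, and this shapes the algorithm. A recursive
    midpoint search would need a stack of frames; the odometer is one tape of uniform digits, and a
    leaf is a sequence of linear passes. Random access to the matrix is avoided as well: it is only
    scanned row by row against a row vector and a column vector, so whatever is asked of it must be
    a Boolean bilinear form in such vectors. Hence symmetry is tested by comparing the forms X M Y
    and Y M X instead of transposed entries. Inclusion in B, rather than equality, makes the final
    test a single pass and lets a midpoint be any superset of the set reached. Since each universal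
    choice follows one half only, the sets A, B, C are updated in place, and n + k(n + 1) digits
    suffice for n vertices and a time bound of k bits. Syntax errors clear a flag but never stop the
    reading loops from terminating. *)

Section WhileLanguage.
Variables (A E : finType).

(* [(l, r)]: [r] starts at the scanned cell, [l] is read leftwards from it. Both
   hold nonblank symbols only, and everything else on the tape is blank. *)
Definition zipper : Type := seq A * seq A.

(* [None] leaves the scanned cell unchanged. *)
Definition op : Type := option A * move.

Definition zhead (z : zipper) : option A := ohead z.2.

(** The case [(None, Stay)] is split off so that an untouched tape reduces to [z] itself and not to
    [(z.1, z.2)]. The results of moves off the ends are dummies, excluded by [zok]. *)
Definition zact (z : zipper) (o : op) : zipper :=
  match o with
  | (None, Stay) => z
  | (oa, mv) =>
    let r := if oa is Some a then a :: behead z.2 else z.2 in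
    match mv with
    | Stay => (z.1, r)
    | MoveRight => if r is a :: r' then (a :: z.1, r') else (z.1, r)
    | MoveLeft => if z.1 is a :: l then (l, a :: r) else (z.1, r)
    end
  end.

(* The action does not step off the left end, leaves no blank gap and respects the
   space bound [B]: exactly then [zact] describes what happens on the tape. *)
Definition zok (B : nat) (z : zipper) (o : op) : bool :=
  match o with
  | (None, Stay) => true
  | (oa, mv) =>
    (if mv is MoveLeft then (if z.1 is _ :: _ then true else false) else true)
    && (if z.2 is _ :: _ then true
        else if oa is Some _ then size z.1 < B
        else if mv is MoveRight then false else true)
  end.

Fixpoint zacts (zs : seq zipper) (os : seq op) : seq zipper :=
  match zs, os with
  | z :: zs', o :: os' => zact z o :: zacts zs' os'
  | _, _ => zs
  end.

Fixpoint zoks (B : nat) (zs : seq zipper) (os : seq op) : bool :=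
  match zs, os with
  | z :: zs', o :: os' => zok B z o && zoks B zs' os'
  | _, _ => true
  end.

(** Tests and actions see only the flags and the scanned symbols, so each of them becomes a single
    machine transition. *)
Inductive prog :=
  | Act of (E -> seq (option A) -> E * seq op)
  | Seq of prog & prog
  | If of (E -> seq (option A) -> bool) & prog & prog
  | While of (E -> seq (option A) -> bool) & prog.

Definition heads (zs : seq zipper) : seq (option A) := map zhead zs.

Definition store : Type := E * seq zipper.

(** A derivation certifies termination and, through the premise of [ExAct], the space bound at every
    step; neither needs a separate argument later. *)
Inductive exec (B : nat) : prog -> store -> store -> Prop :=
  | ExAct f e zs : zoks B zs (f e (heads zs)).2 ->
      exec B (Act f) (e, zs) ((f e (heads zs)).1, zacts zs (f e (heads zs)).2)
  | ExSeq p q s1 s2 s3 : exec B p s1 s2 -> exec B q s2 s3 ->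
      exec B (Seq p q) s1 s3
  | ExIf b p q s s' :
      exec B (if b s.1 (heads s.2) then p else q) s s' -> exec B (If b p q) s s'
  | ExWhileF b p s : b s.1 (heads s.2) = false -> exec B (While b p) s s
  | ExWhileT b p s1 s2 s3 : b s1.1 (heads s1.2) = true -> exec B p s1 s2 ->
      exec B (While b p) s2 s3 -> exec B (While b p) s1 s3.

Lemma exec_act B f e zs s' :
  zoks B zs (f e (heads zs)).2 ->
  ((f e (heads zs)).1, zacts zs (f e (heads zs)).2) = s' ->
  exec B (Act f) (e, zs) s'.
Proof. by move=> ok <-; apply: ExAct. Qed.

(** Control points. In a conditional or a loop, [None] is the point at which the test is
    evaluated. *)
Fixpoint pstate (p : prog) : finType :=
  match p with
  | Act _ => unit
  | Seq p q => (pstate p + pstate q)%type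
  | If _ p q => option (pstate p + pstate q)%type
  | While _ p => option (pstate p)
  end.

Fixpoint entry (p : prog) : pstate p :=
  match p with
  | Act _ => tt
  | Seq p q => inl (entry p)
  | If _ p q => None
  | While _ p => None
  end.

(* The successor state [None] means that [p] has terminated. *)
Fixpoint ptrans (p : prog) : pstate p -> E -> seq (option A) ->
    option (pstate p) * (E * seq op) :=
  match p with
  | Act f => fun _ e h => (None, f e h)
  | Seq p q => fun s e h =>
    match s with
    | inl s1 => let: (o, r) := ptrans s1 e h in
        (Some (if o is Some s' then inl s' else inr (entry q)), r)
    | inr s2 => let: (o, r) := ptrans s2 e h in (omap inr o, r)
    end
  | If b p q => fun s e h =>
    match s with
    | None => (Some (Some (if b e h then inl (entry p) else inr (entry q))),
               (e, [::]))
    | Some (inl s1) => let: (o, r) := ptrans s1 e h in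
        (omap (fun x => Some (inl x)) o, r)
    | Some (inr s2) => let: (o, r) := ptrans s2 e h in
        (omap (fun x => Some (inr x)) o, r)
    end
  | While b p => fun s e h =>
    match s with
    | None => ((if b e h then Some (Some (entry p)) else None), (e, [::]))
    | Some s1 => let: (o, r) := ptrans s1 e h in (Some o, r)
    end
  end.

Inductive runs (B : nat) (p : prog) : option (pstate p) -> store ->
    option (pstate p) -> store -> Prop :=
  | RunsRefl o s : runs B o s o s
  | RunsStep q e zs o s : zoks B zs (ptrans q e (heads zs)).2.2 ->
      runs B (ptrans q e (heads zs)).1
        ((ptrans q e (heads zs)).2.1, zacts zs (ptrans q e (heads zs)).2.2) o s ->
      runs B (Some q) (e, zs) o s.

Lemma runs_trans B p (o1 o2 o3 : option (pstate p)) s1 s2 s3 :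
  runs B o1 s1 o2 s2 -> runs B o2 s2 o3 s3 -> runs B o1 s1 o3 s3.
Proof. by move=> r; elim: r => // q e zs o s ok _ IH /IH; apply: RunsStep. Qed.

(** Transports a run of a subprogram into the surrounding program: [psi] embeds the control points,
    and [phi None] is the place where control goes when the subprogram ends. *)
Lemma runs_map B p p' (phi : option (pstate p) -> option (pstate p'))
    (psi : pstate p -> pstate p') :
  (forall s, phi (Some s) = Some (psi s)) ->
  (forall s e h, ptrans (psi s) e h = (phi (ptrans s e h).1, (ptrans s e h).2)) ->
  forall o s o' s', runs B o s o' s' -> runs B (phi o) s (phi o') s'.
Proof.
move=> phiE psiE o s o' s'; elim=> [*|q e zs o1 s1 ok _ IH].
  exact: RunsRefl.
by rewrite phiE; apply: RunsStep; rewrite psiE.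
Qed.

Lemma zacts0 zs : zacts zs [::] = zs. Proof. by case: zs. Qed.
Lemma zoks0 B zs : zoks B zs [::]. Proof. by case: zs. Qed.

Lemma exec_runs B p s s' : exec B p s s' -> runs B (Some (entry p)) s None s'.
Proof.
elim=> {p s s'}.
- by move=> f e zs ok; apply: RunsStep => //; apply: RunsRefl.
- move=> p q s1 s2 s3 _ IHp _ IHq.
  pose phi (o : option (pstate p)) : option (pstate (Seq p q)) :=
    Some (if o is Some s' then inl s' else inr (entry q)).
  apply: (@runs_trans _ _ _ (phi None) _ _ s2).
    apply: (@runs_map _ _ (Seq p q) phi inl _ _ (Some (entry p)) _ None) => //.
    by move=> s e h /=; case: (ptrans s e h).
  apply: (@runs_map _ _ (Seq p q) (omap inr) inr _ _ (Some (entry q)) _ None) => //.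
  by move=> s e h /=; case: (ptrans s e h).
- move=> b p q [e zs] s' _ IH.
  apply: RunsStep; first by rewrite /= zoks0.
  rewrite /= zacts0 /=; move: IH => /=; case: (b e (heads zs)) => IH.
    apply: (@runs_map _ _ (If b p q) (omap (fun x => Some (inl x)))
             (fun x => Some (inl x)) _ _ (Some (entry p)) _ None) => //.
    by move=> s e' h /=; case: (ptrans s e' h).
  apply: (@runs_map _ _ (If b p q) (omap (fun x => Some (inr x)))
           (fun x => Some (inr x)) _ _ (Some (entry q)) _ None) => //.
  by move=> s e' h /=; case: (ptrans s e' h).
- move=> b p [e zs] /= bF; apply: RunsStep; first by rewrite /= zoks0.
  by rewrite /= bF zacts0; apply: RunsRefl.
- move=> b p [e zs] s2 s3 /= bT _ IHp _ IHw.
  apply: RunsStep; first by rewrite /= zoks0.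
  rewrite /= bT zacts0; apply: runs_trans IHw.
  apply: (@runs_map _ _ (While b p) Some Some _ _ (Some (entry p)) _ None) => //.
  by move=> s e' h /=; case: (ptrans s e' h).
Qed.

End WhileLanguage.

(** * Compilation to Turing machines *)

Section Compilation.
Variables (Sigma X E : finType) (k : nat).
Local Notation A := (Sigma + X)%type.
Variables (p : prog A E) (e0 : E) (res : E -> bool).

Definition compiled_trans (s : option (pstate p) * E)
    (h : {ffun 'I_k.+1 -> option A}) :
    (option (pstate p) * E) * {ffun 'I_k.+1 -> option A * move} :=
  if s is (Some q, e) then
    let: (o, (e', ops)) := ptrans q e [seq h i | i <- enum 'I_k.+1] in
    ((o, e'), [ffun i : 'I_k.+1 =>
                let o := nth (None, Stay) ops i in
                (if o.1 is Some a then Some a else h i, o.2)])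
  else (s, [ffun i => (h i, Stay)]).

Definition compiled : TM Sigma :=
  @MkTM Sigma (option (pstate p) * E)%type X k (Some (entry p), e0)
    (fun s => if s.1 is None then Some (res s.2) else None) compiled_trans.

(** The machine tape may end in [v] blanks that were visited; they count as space but are absent
    from the zipper, hence the separate bound [B.+1]. *)
Definition tape_sim (B : nat) (t : tape A) (z : zipper A) : Prop :=
  [/\ tape_left t = map Some z.1,
      exists v, tape_head t :: tape_right t = map Some z.2 ++ nseq v None,
      size z.1 + size z.2 <= B & tape_size t <= B.+1].

Lemma tape_sim_head B t z : tape_sim B t z -> tape_head t = zhead z.
Proof. by case: t z => l h r [zl [|a zr]] [_ [[|v]] //= [-> _]]. Qed.

Lemma tape_sim_act B t z o : zok B z o -> tape_sim B t z ->
  tape_sim B (tape_act t (if o.1 is Some a then Some a else tape_head t, o.2))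
    (zact z o).
Proof.
case: t z o => l h r [zl zr] [oa mv] okz [lE [v hr] szz szt].
rewrite /= in lE hr szz.
(* Writing is separated from moving: [w] is the symbol left in the scanned cell and [r'] the right
   half of the zipper after the write. *)
have [w wE] : {w | w = if oa is Some a then Some a else h} by eexists.
have [r' r'E] : {r' | r' = if oa is Some a then a :: behead zr else zr}.
  by eexists.
have [v' wr] : exists v', w :: r = map Some r' ++ nseq v' None.
  rewrite wE r'E; case: (oa) => [a|]; last by exists v.
  case: (zr) hr => [|b zr'] /=; last by case=> _ ->; exists v.
  by case: v => [|v] // [_ ->]; exists v.
(* Only a write onto a blank lengthens the data, and there [zok] demands [size zl < B]. *)
have szr : size zl + size r' <= B.
  move: okz szz; rewrite r'E; case: (oa) => [a|] //.
  by case: (zr) => //= /andP[_]; rewrite addn1.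
have {szt}sz : size zl + size r <= B by move: szt; rewrite /tape_size lE size_map.
have -> : zact (zl, zr) (oa, mv) = match mv with
    | Stay => (zl, r')
    | MoveRight => if r' is a :: r' then (a :: zl, r') else (zl, r')
    | MoveLeft => if zl is a :: l then (l, a :: r') else (zl, r')
    end by rewrite /zact r'E; case: (oa) => [a|]; case: (mv).
rewrite /= -wE; case: mv okz => /= okz.
- case: zl lE sz szr okz {szz} => [|c zl] -> sz szr /=; first by case: (oa).
  move=> _; split=> //=; first by exists v'; rewrite wr.
  + by rewrite addnS.
  + by rewrite /tape_size /= size_map addnS ltnS.
- by split=> //=; [exists v' | rewrite /tape_size lE size_map ltnS].
- case: r' wr szr r'E => [|c r'] wr szr r'E.
    exfalso; move: okz r'E; case: (oa) => // ; case: (zr) => //.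
  case: wr => -> rE; split=> /=; first by rewrite lE.
  + rewrite rE; case: (r') => [|d r''] /=; last by exists v'.
    (* Stepping past the last symbol meets a fresh blank unless visited blanks are already there. *)
    by case: (v') => [|u]; [exists 1 | exists u.+1].
  + by rewrite addSnnS.
  + rewrite /tape_size /= lE size_map size_behead.
    case: (r) sz => [|d r0] /= sz; last by rewrite addSnnS ltnS.
    by rewrite addn0 ltnS (leq_trans _ szr) // /= addnS ltnS leq_addr.
Qed.

Definition cfg_sim (B : nat) (c : config compiled) (o : option (pstate p))
    (s : store A E) : Prop :=
  [/\ cfg_state c = (o, s.1), size s.2 = k.+1 &
      forall i : 'I_k.+1, tape_sim B (cfg_tapes c i) (nth ([::], [::]) s.2 i)].

Lemma cfg_sim_space B c o s : cfg_sim B c o s -> cfg_space c <= k.+1 * B.+1.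
Proof.
case=> _ _ sim; have -> : k.+1 * B.+1 = \sum_(i < k.+1) B.+1.
  by rewrite sum_nat_const card_ord.
by apply: leq_sum => i _; case: (sim i).
Qed.

Lemma size_zacts (zs : seq (zipper A)) os : size (zacts zs os) = size zs.
Proof. by elim: zs os => [|z zs IH] [|o os] //=; rewrite IH. Qed.

Lemma nth_zacts z0 (zs : seq (zipper A)) os i : i < size zs ->
  nth z0 (zacts zs os) i = zact (nth z0 zs i) (nth (None, Stay) os i).
Proof.
elim: zs os i => [|z zs IH] [|o os] [|i] //= lt; by rewrite IH.
Qed.

Lemma zoks_nth B z0 (zs : seq (zipper A)) os i : i < size zs -> zoks B zs os ->
  zok B (nth z0 zs i) (nth (None, Stay) os i).
Proof.
elim: zs os i => [|z zs IH] [|o os] [|i] //= lt; rewrite ?nth_nil //.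
  by case/andP.
by case/andP=> _; apply: IH.
Qed.

Lemma cfg_sim_step B c q e zs : cfg_sim B c (Some q) (e, zs) ->
  zoks B zs (ptrans q e (heads zs)).2.2 ->
  cfg_sim B (tm_step c) (ptrans q e (heads zs)).1
    ((ptrans q e (heads zs)).2.1, zacts zs (ptrans q e (heads zs)).2.2).
Proof.
case: c => st tp [/= -> szs sim] ok.
have hE : [seq [ffun i => tape_head (tp i)] i | i <- enum 'I_k.+1] = heads zs.
  apply: (@eq_from_nth _ None); first by rewrite [RHS]size_map size_map size_enum_ord szs.
  move=> i; rewrite size_map size_enum_ord => lti.
  rewrite (nth_map ord0) ?size_enum_ord // (nth_map ([::], [::])) ?szs // ffunE.
  by rewrite (tape_sim_head (sim _)) nth_enum_ord.
rewrite /tm_step /= hE; move: ok; case: (ptrans q e (heads zs)) => o [e' ops] /= ok.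
split=> //=; first by rewrite size_zacts.
move=> i; rewrite !ffunE /= nth_zacts ?szs //.
by apply: tape_sim_act => //; apply: zoks_nth; rewrite ?szs.
Qed.

Lemma cfg_sim_runs B o s o' s' : runs B o s o' s' -> forall c, cfg_sim B c o s ->
  exists t, cfg_sim B (iter t (@tm_step _ compiled) c) o' s' /\
    forall t', t' <= t -> cfg_space (iter t' (@tm_step _ compiled) c) <= k.+1 * B.+1.
Proof.
elim=> [{}o {}s c sim|q e zs o1 s1 ok _ IH c sim].
  by exists 0; split=> // t'; rewrite leqn0 => /eqP->; apply: cfg_sim_space sim.
have [t [sim' spc]] := IH _ (cfg_sim_step sim ok).
exists t.+1; rewrite iterSr; split=> // -[_|t' lt].
  exact: cfg_sim_space sim.
by rewrite iterSr; apply: spc.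
Qed.

(** Each of the [k.+1] tapes holds at most [B n] data cells and takes up at most one cell more, on
    account of visited blanks. The input cells count as space, hence [n <= B n]. *)
Lemma compiled_PSPACE (L : seq Sigma -> Prop) (B : nat -> nat) (c d : nat) :
  (forall n, n <= B n) ->
  (forall n, k.+1 * (B n).+1 <= c * n ^ d + c) ->
  (forall w, exists s, exec (B (size w)) p
     (e0, ([::], map inl w) :: nseq k ([::], [::])) s /\ (res s.1 <-> L w)) ->
  PSPACE L.
Proof.
move=> Bw Bcd corr.
have run w : exists s t, [/\ cfg_sim (B (size w)) (tm_run compiled w t) None s,
    res s.1 <-> L w &
    forall t', t' <= t -> cfg_space (tm_run compiled w t') <= c * size w ^ d + c].
  have [s [/exec_runs rs resL]] := corr w.
  have [|t [sim spc]] := cfg_sim_runs rs (c := tm_init compiled w).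
    split=> //=; first by rewrite size_nseq.
    move=> i; rewrite ffunE; case: (i) => -[|j] lti /=.
      case: w {rs resL} (Bw (size w)) => [|a w] bnd.
        by split=> //=; exists 1.
      split=> //=; first by exists 0; rewrite cats0.
        by rewrite size_map.
      by rewrite /tape_size /= !size_map (leq_trans bnd).
    rewrite nth_nseq if_same; split=> //=.
    by exists 1.
  exists s, t; split=> // t' /spc le; exact: leq_trans le (Bcd _).
exists compiled, c, d; split=> w.
  have [s [t [[st _ _] resL _]]] := run w; exists t, (res s.1).
  by rewrite st /=; split.
move=> t'; have [s [t [[st _ _] _ spc]]] := run w.
(* After halting the configuration is frozen, which extends the bound to all times. *)
have [/spc //|/ltnW lt] := leqP t' t.
have -> : tm_run compiled w t' = tm_run compiled w t; last exact: spc.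
rewrite -(subnK lt); elim: (t' - t) => // u IH.
by rewrite /tm_run in IH *; rewrite addSn iterS IH /tm_step st.
Qed.

End Compilation.

(** * The program *)

(* Tape 0 holds the input. The other tapes start with [marker], followed by cells:
   - tape 1 (row vector): the bits [X, Y], or the indicator of [A :\: F];
   - tape 2 (column vector): the bits [X, Y], or the indicators of [A, B, C];
   - tape 3: the adjacency matrix;
   - tape 4: the bits of [m], each with the current bit of a counter;
   - tape 5: the bits of the time bound;
   - tape 6: the odometer, with digits [(universal?, bit, bit, partial result)].
   The flags are: input well formed / loop running, odometer carrying, truth value,
   and four scratch bits. *)
Definition cell : finType := (bool * bool * bool * bool)%type.
Definition symbol : finType := (letter + option cell)%type.
Definition flags : finType := (bool * bool * bool * bool * bool * bool * bool)%type.
Definition fprog := prog symbol flags.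

Definition marker : symbol := inr None.
Definition data (c : cell) : symbol := inr (Some c).
Definition cell0 : cell := (false, false, false, false).

Definition keep : op symbol := (None, Stay).
Definition go_right : op symbol := (None, MoveRight).
Definition go_left : op symbol := (None, MoveLeft).
Definition put_right (c : cell) : op symbol := (Some (data c), MoveRight).
Definition put (c : cell) : op symbol := (Some (data c), Stay).

Definition rd (h : seq (option symbol)) (i : nat) : cell :=
  if nth None h i is Some (inr (Some c)) then c else cell0.

Definition nonblank (i : nat) (e : flags) (h : seq (option symbol)) : bool :=
  if nth None h i is Some _ then true else false.

Declare Scope fprog_scope.
Notation "p ;; q" := (Seq p q) (at level 55, right associativity) : fprog_scope.
Local Open Scope fprog_scope.

(** Only the marker stops the loop, so it may start on the blank behind the data. A head cannot
    sense the left end, which [zok] forbids to cross. The input tape has no marker: it is read once,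
    from left to right. *)
Definition rewind (i : nat) : fprog :=
  While (fun _ h => if nth None h i is Some (inr None) then false else true)
    (Act (fun e _ => (e, ncons i keep [:: go_left]))) ;;
  Act (fun e _ => (e, ncons i keep [:: go_right])).

Definition fail (e : flags) : flags :=
  let: (ok, up, v, e1, e2, e3, e4) := e in (false, up, v, e1, e2, e3, e4).

Definition mark_tapes : fprog :=
  Act (fun e _ => (e, keep :: nseq 6 (Some marker, MoveRight))).

(** From here on the lengths of tapes 1 and 2 are the record of the number of vertices, and every
    loop over vertices runs along one of them. *)
Definition ones_loop : fprog :=
  While (fun _ h => if nth None h 0 is Some (inl (Some true)) then true else false)
    (Act (fun e _ => (e, [:: go_right; put_right cell0; put_right cell0]))).

Definition read_ones : fprog := ones_loop ;; rewind 1 ;; rewind 2.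

Definition read_hash : fprog :=
  Act (fun e h => if nth None h 0 is Some (inl None) then (e, [:: go_right])
                  else (fail e, [::])).

(** A missing bit clears the first flag but still advances tape 2, so the loop ends on every
    input. *)
Definition row_loop : fprog :=
  While (nonblank 2)
    (Act (fun e h => if nth None h 0 is Some (inl (Some b))
                     then (e, [:: go_right; keep; go_right; put_right (b, false, false, false)])
                     else (fail e, [:: keep; keep; go_right]))).

Definition matrix_loop : fprog :=
  While (nonblank 1) (row_loop ;; rewind 2 ;; Act (fun e _ => (e, [:: keep; go_right]))).

Definition read_matrix : fprog := matrix_loop ;; rewind 1 ;; rewind 3.

Definition set1 (b : bool) (e : flags) : flags :=
  let: (ok, up, v, e1, e2, e3, e4) := e in (ok, up, v, b, e2, e3, e4).

Definition bits_loop (i : nat) : fprog :=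
  While (fun _ h => if nth None h 0 is Some (inl (Some b)) then true else false)
    (Act (fun e h => if nth None h 0 is Some (inl (Some b))
                     then (set1 b e, go_right :: ncons i keep [:: put_right (b, b, false, false)])
                     else (e, [::]))).

Definition read_bits (i : nat) : fprog :=
  Act (fun e _ => (set1 false e, [::])) ;; bits_loop i ;; rewind i.+1.

Definition check_last : fprog :=
  Act (fun e _ => let: (ok, up, v, e1, e2, e3, e4) := e in
                  ((ok && e1, up, v, e1, e2, e3, e4), [::])).

Definition check_end : fprog :=
  Act (fun e h => (if nth None h 0 is None then e else fail e, [::])).

Definition copy_loop : fprog :=
  While (nonblank 1)
    (Act (fun e _ => (e, [:: keep; go_right; keep; keep; keep;
                             put_right (true, true, false, false)]))).

Definition copy_time : fprog := copy_loop ;; rewind 1 ;; rewind 5.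

Definition qreset (k : bool) : cell := (k, false, false, k).

Definition push_loop (k : bool) : fprog :=
  While (nonblank 2)
    (Act (fun e _ => (e, [:: keep; keep; go_right; keep; keep; keep;
                             put_right (qreset k)]))).

Definition levels_loop : fprog :=
  While (nonblank 5)
    (push_loop false ;; rewind 2 ;;
     Act (fun e _ => (e, [:: keep; keep; keep; keep; keep; go_right; put_right (qreset true)]))).

(** The order of the digits: [n] universal ones for X and Y, then for each bit of the time bound [n]
    existential ones for F and C and a universal one for the half. The head of tape 6 stays behind
    the last digit; [leaf] rewinds it. *)
Definition build : fprog := push_loop true ;; rewind 2 ;; levels_loop ;; rewind 5.

(** As the matrix is stored row by row, one pass along tape 2 per cell of tape 1 keeps the three
    heads aligned without any index arithmetic. *)
Definition nest_inner (g : flags -> cell -> bool -> cell -> flags * cell) : fprog :=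
  While (nonblank 2)
    (Act (fun e h => let: (b, _, _, _) := rd h 3 in
                     let r := g e (rd h 1) b (rd h 2) in
                     (r.1, [:: keep; keep; put_right r.2; go_right]))).

Definition nest_outer (g : flags -> cell -> bool -> cell -> flags * cell) : fprog :=
  While (nonblank 1) (nest_inner g ;; rewind 2 ;; Act (fun e _ => (e, [:: keep; go_right]))).

Definition nest (g : flags -> cell -> bool -> cell -> flags * cell) : fprog :=
  nest_outer g ;; rewind 1 ;; rewind 3.

(** The flags [e1], [e2], [e3] accumulate the Boolean forms X M Y, Y M X and X M X of the matrix
    M. *)
Definition gsym (e : flags) (u : cell) (m : bool) (v : cell) : flags * cell :=
  let: (ok, up, val, e1, e2, e3, e4) := e in
  let: (ux, uy, _, _) := u in
  let: (vx, vy, _, _) := v in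
  ((ok, up, val, e1 || [&& ux, m & vy], e2 || [&& uy, m & vx],
    e3 || [&& ux, m & vx], e4), v).

Definition glev (e : flags) (u : cell) (m : bool) (v : cell) : flags * cell :=
  let: (ok, up, val, e1, e2, e3, e4) := e in
  let: (ux, _, _, _) := u in
  let: (a, b, c, d) := v in
  (e, (a || [&& e1, ux & m], b, c, d)).

Definition load_xy_loop : fprog :=
  While (nonblank 2)
    (Act (fun e h =>
       let: (ok, up, val, e1, e2, e3, e4) := e in
       let: (_, x, y, _) := rd h 6 in
       let c := (x && ~~ e4, y, false, false) in
       ((ok, up, val, e1, e2, e3, e4 || x),
        [:: keep; put_right c; put_right c; keep; keep; keep; go_right]))).

Definition load_xy : fprog := load_xy_loop ;; rewind 1 ;; rewind 2.

Definition reset_ab_loop : fprog :=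
  While (nonblank 2)
    (Act (fun e _ => (e, [:: keep; keep; put_right (true, false, false, false)]))).

Definition reset_ab : fprog := reset_ab_loop ;; rewind 2.

Definition borrow_loop : fprog :=
  While (fun _ h => if nth None h 4 is Some (inr (Some (_, c, _, _))) then ~~ c
                    else false)
    (Act (fun e h => let: (m, _, _, _) := rd h 4 in
                     (e, [:: keep; keep; keep; keep; put_right (m, true, false, false)]))).

(** Starting from [m], one decrement per element of F underflows exactly when F has more than [m]
    elements. An underflow clears the truth value and the run goes on. *)
Definition decrement : fprog :=
  borrow_loop ;;
  Act (fun e h =>
    let: (ok, up, val, e1, e2, e3, e4) := e in
    let: (m, _, _, _) := rd h 4 in
    if nonblank 4 e h then (e, [:: keep; keep; keep; keep; put (m, false, false, false)])
    else ((ok, up, false, e1, e2, e3, e4), [::])) ;;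
  rewind 4.

Definition skip : fprog := Act (fun e _ => (e, [::])).

(** Here [e1] holds the time bit: only if it is set are the elements of F charged to the counter and
    removed from A in the column vector. *)
Definition load_fc_loop : fprog :=
  While (nonblank 2)
    (If (fun e h => let: (ok, up, val, e1, e2, e3, e4) := e in
                    let: (_, f, _, _) := rd h 6 in e1 && f) decrement skip ;;
     Act (fun e h =>
       let: (ok, up, val, e1, e2, e3, e4) := e in
       let: (_, f, c, _) := rd h 6 in
       let: (a, b, _, _) := rd h 2 in
       (e, [:: keep; put_right (a && ~~ f, false, false, false);
               put_right (if e1 then a && ~~ f else a, b, c, false); keep; keep; keep; go_right]))).

Definition load_fc : fprog := load_fc_loop ;; rewind 1 ;; rewind 2.

(** The flag [e2] selects the half: from C to B if it is set, from the current set to C otherwise.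
    The other half is tried at another reading of the odometer. *)
Definition choose_loop : fprog :=
  While (nonblank 2)
    (Act (fun e h =>
       let: (ok, up, val, e1, e2, e3, e4) := e in
       let: (a, b, c, _) := rd h 2 in
       (e, [:: keep; keep; put_right (if e2 then (c, b, c, false) else (a, c, c, false))]))).

Definition choose_half : fprog := choose_loop ;; rewind 2.

Definition counter_loop : fprog :=
  While (nonblank 4)
    (Act (fun e h => let: (m, _, _, _) := rd h 4 in
                     (e, [:: keep; keep; keep; keep; put_right (m, m, false, false)]))).

Definition reset_counter : fprog := counter_loop ;; rewind 4.

Definition level : fprog :=
  Act (fun e h => let: (t, _, _, _) := rd h 5 in
                  (set1 t e, [:: keep; keep; keep; keep; keep; go_right])) ;;
  load_fc ;;
  nest glev ;;
  Act (fun e h =>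
    let: (ok, up, val, e1, e2, e3, e4) := e in
    let: (_, ch, _, _) := rd h 6 in
    ((ok, up, val, e1, ch, e3, e4), [:: keep; keep; keep; keep; keep; keep; go_right])) ;;
  choose_half ;; reset_counter.

Definition subset_loop : fprog :=
  While (nonblank 2)
    (Act (fun e h =>
       let: (ok, up, val, e1, e2, e3, e4) := e in
       let: (a, b, c, _) := rd h 2 in
       ((ok, up, val && (a ==> b), e1, e2, e3, e4), [:: keep; keep; go_right]))).

Definition check_subset : fprog := subset_loop ;; rewind 2.

(** Evaluates the quantifier-free part at the current reading. Between two leaves only the lengths
    of tapes 1 and 2 persist, so their contents may be overwritten. *)
Definition leaf : fprog :=
  rewind 6 ;;
  Act (fun e _ => let: (ok, up, val, e1, e2, e3, e4) := e in
                  ((ok, up, val, false, false, false, false), [::])) ;;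
  load_xy ;; nest gsym ;;
  Act (fun e _ => let: (ok, up, val, e1, e2, e3, e4) := e in
                  ((ok, up, (e1 == e2) && ~~ e3, e1, e2, e3, e4), [::])) ;;
  reset_ab ;;
  While (nonblank 5) level ;; rewind 5 ;;
  check_subset ;;
  Act (fun e _ => let: (ok, up, val, e1, e2, e3, e4) := e in
                  ((ok, true, val, e1, e2, e3, e4), [::])).

(* A digit runs through 00, 01, 10, 11. *)
Definition carry : fprog :=
  Act (fun e _ => (e, [:: keep; keep; keep; keep; keep; keep; go_left])) ;;
  Act (fun e h =>
    let: (ok, up, val, e1, e2, e3, e4) := e in
    if nth None h 6 is Some (inr (Some (k, b1, b2, acc))) then
      let val' := if k then acc && val else acc || val in
      if b1 && b2 then ((ok, up, val', e1, e2, e3, e4),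
                        [:: keep; keep; keep; keep; keep; keep; put (qreset k)])
      else ((ok, false, val, e1, e2, e3, e4),
            [:: keep; keep; keep; keep; keep; keep; put (k, b1 || b2, ~~ b2, val')])
    else (fail e, [::])).

(** The loop ends when a carry runs into the marker: [fail] then signals completion, and the truth
    flag holds the value of the whole formula. *)
Definition odometer : fprog :=
  While (fun e _ => let: (ok, up, val, e1, e2, e3, e4) := e in ok)
    (If (fun e _ => let: (ok, up, val, e1, e2, e3, e4) := e in up) carry leaf).

Definition read_time (timed : bool) : fprog :=
  if timed then check_last ;; read_hash ;; read_bits 4 ;; check_last ;; check_end
  else check_last ;; check_end ;; copy_time.

Definition firefighter (timed : bool) : fprog :=
  mark_tapes ;; read_ones ;; read_hash ;; read_matrix ;; read_hash ;; read_bits 3 ;;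
  read_time timed ;;
  If (fun e _ => let: (ok, up, val, e1, e2, e3, e4) := e in ok)
    (build ;; odometer) skip.

(** * Executing the program *)

Definition zipper0 : zipper symbol := ([::], [::]).

Lemma zacts_ncons (zs : seq (zipper symbol)) i o : i < size zs ->
  zacts zs (ncons i keep [:: o]) = set_nth zipper0 zs i (zact (nth zipper0 zs i) o).
Proof.
elim: zs i => [|z zs IH] [|i] //= lt; first by rewrite zacts0.
by rewrite IH.
Qed.

Lemma zoks_ncons B (zs : seq (zipper symbol)) i o : i < size zs ->
  zoks B zs (ncons i keep [:: o]) = zok B (nth zipper0 zs i) o.
Proof.
elim: zs i => [|z zs IH] [|i] //= lt; first by rewrite zoks0 andbT.
by rewrite IH.
Qed.

Lemma nth_heads (zs : seq (zipper symbol)) i :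
  nth None (heads zs) i = zhead (nth zipper0 zs i).
Proof. by elim: zs i => [|z zs IH] [|i] //=; rewrite IH. Qed.

(** The standard shape of a work tape: the marker, then [rev l], then [r] from the scanned cell
    on. *)
Definition wz (l r : seq cell) : zipper symbol := (map data l ++ [:: marker], map data r).

Lemma exec_rewind B i e zs l r : i < size zs -> nth zipper0 zs i = wz l r ->
  exec B (rewind i) (e, zs) (e, set_nth zipper0 zs i (wz [::] (catrev l r))).
Proof.
move=> lti zsi.
apply: (@ExSeq _ _ _ _ _ _
  (e, set_nth zipper0 zs i ([::], marker :: map data (catrev l r)))); last first.
  apply: exec_act; rewrite ?zacts_ncons ?zoks_ncons ?size_set_nth ?leq_max ?leqnn //.
    by rewrite nth_set_nth /= eqxx.
  by rewrite nth_set_nth /= eqxx set_set_nth eqxx.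
elim: l zs r lti zsi => [|x l IH] zs r lti zsi.
  apply: (@ExWhileT _ _ _ _ _ _ (e, set_nth zipper0 zs i ([::], marker :: map data r))).
  - by rewrite nth_heads zsi; case: (r).
  - by apply: exec_act; rewrite ?zacts_ncons ?zoks_ncons // zsi; case: (r).
  - by apply: ExWhileF; rewrite nth_heads nth_set_nth /= eqxx.
have zsi' : nth zipper0 (set_nth zipper0 zs i (wz l (x :: r))) i = wz l (x :: r).
  by rewrite nth_set_nth /= eqxx.
apply: (@ExWhileT _ _ _ _ _ _ (e, set_nth zipper0 zs i (wz l (x :: r)))).
- by rewrite nth_heads zsi; case: (r).
- by apply: exec_act; rewrite ?zacts_ncons ?zoks_ncons // zsi; case: (r).
have := IH _ (x :: r) _ zsi'; rewrite size_set_nth leq_max ltnSn => /(_ isT).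
by rewrite set_set_nth eqxx; apply.
Qed.

Section Exec.
Variable B : nat.
Local Notation exec := (exec B).
Implicit Types (z : zipper symbol).

Local Notation T7 z0 z1 z2 z3 z4 z5 z6 := [:: z0; z1; z2; z3; z4; z5; z6].

Lemma rewind1 e z0 l r z2 z3 z4 z5 z6 :
  exec (rewind 1) (e, T7 z0 (wz l r) z2 z3 z4 z5 z6)
    (e, T7 z0 (wz [::] (catrev l r)) z2 z3 z4 z5 z6).
Proof. exact: exec_rewind. Qed.

Lemma rewind2 e z0 z1 l r z3 z4 z5 z6 :
  exec (rewind 2) (e, T7 z0 z1 (wz l r) z3 z4 z5 z6)
    (e, T7 z0 z1 (wz [::] (catrev l r)) z3 z4 z5 z6).
Proof. exact: exec_rewind. Qed.

Lemma rewind3 e z0 z1 z2 l r z4 z5 z6 :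
  exec (rewind 3) (e, T7 z0 z1 z2 (wz l r) z4 z5 z6)
    (e, T7 z0 z1 z2 (wz [::] (catrev l r)) z4 z5 z6).
Proof. exact: exec_rewind. Qed.

Lemma rewind4 e z0 z1 z2 z3 l r z5 z6 :
  exec (rewind 4) (e, T7 z0 z1 z2 z3 (wz l r) z5 z6)
    (e, T7 z0 z1 z2 z3 (wz [::] (catrev l r)) z5 z6).
Proof. exact: exec_rewind. Qed.

Lemma rewind5 e z0 z1 z2 z3 z4 l r z6 :
  exec (rewind 5) (e, T7 z0 z1 z2 z3 z4 (wz l r) z6)
    (e, T7 z0 z1 z2 z3 z4 (wz [::] (catrev l r)) z6).
Proof. exact: exec_rewind. Qed.

Lemma rewind6 e z0 z1 z2 z3 z4 z5 l r :
  exec (rewind 6) (e, T7 z0 z1 z2 z3 z4 z5 (wz l r))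
    (e, T7 z0 z1 z2 z3 z4 z5 (wz [::] (catrev l r))).
Proof. exact: exec_rewind. Qed.

Lemma rewind1_end e s z0 z2 z3 z4 z5 z6 :
  exec (rewind 1) (e, T7 z0 (wz (rev s) [::]) z2 z3 z4 z5 z6)
    (e, T7 z0 (wz [::] s) z2 z3 z4 z5 z6).
Proof. by rewrite -{2}(revK s); apply: rewind1. Qed.

Lemma rewind2_end e s z0 z1 z3 z4 z5 z6 :
  exec (rewind 2) (e, T7 z0 z1 (wz (rev s) [::]) z3 z4 z5 z6)
    (e, T7 z0 z1 (wz [::] s) z3 z4 z5 z6).
Proof. by rewrite -{2}(revK s); apply: rewind2. Qed.

Lemma rewind3_end e s z0 z1 z2 z4 z5 z6 :
  exec (rewind 3) (e, T7 z0 z1 z2 (wz (rev s) [::]) z4 z5 z6)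
    (e, T7 z0 z1 z2 (wz [::] s) z4 z5 z6).
Proof. by rewrite -{2}(revK s); apply: rewind3. Qed.

Lemma rewind4_end e s z0 z1 z2 z3 z5 z6 :
  exec (rewind 4) (e, T7 z0 z1 z2 z3 (wz (rev s) [::]) z5 z6)
    (e, T7 z0 z1 z2 z3 (wz [::] s) z5 z6).
Proof. by rewrite -{2}(revK s); apply: rewind4. Qed.

Lemma rewind5_end e s z0 z1 z2 z3 z4 z6 :
  exec (rewind 5) (e, T7 z0 z1 z2 z3 z4 (wz (rev s) [::]) z6)
    (e, T7 z0 z1 z2 z3 z4 (wz [::] s) z6).
Proof. by rewrite -{2}(revK s); apply: rewind5. Qed.

(** * Reading the input *)

Definition mc (b : bool) : cell := (b, false, false, false).
Definition pc (b : bool) : cell := (b, b, false, false).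

Definition not_one (r : seq letter) : bool := if r is Some true :: _ then false else true.
Definition not_bit (r : seq letter) : bool := if r is Some _ :: _ then false else true.
Definition is_hash (r : seq letter) : bool := if r is None :: _ then true else false.

(** Only the unread part [r] matters, as tape 0 is never rewound; the part [zl] already read is
    therefore existential in the lemmas below. *)
Definition inz (zl : seq symbol) (r : seq letter) : zipper symbol := (zl, map inl r).

Lemma exec_ones_loop e zl k l r z3 z4 z5 z6 : not_one r -> k + size l < B ->
  exists zl', exec ones_loop
    (e, T7 (inz zl (nseq k (Some true) ++ r)) (wz l [::]) (wz l [::]) z3 z4 z5 z6)
    (e, T7 (inz zl' r) (wz (catrev (nseq k cell0) l) [::])
        (wz (catrev (nseq k cell0) l) [::]) z3 z4 z5 z6).
Proof.
move=> rP; elim: k l zl => [|k IH] l zl /= lB.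
  by exists zl; apply: ExWhileF; case: r rP => [|[[]|] r].
have [|zl' ex] := IH (cell0 :: l) (inl (Some true) :: zl); first by rewrite /= addnS.
exists zl'; apply: (ExWhileT _ _ ex) => //; apply: exec_act => //=.
by rewrite size_cat size_map /= addn1 andbT andbb (leq_trans _ lB) // !ltnS leq_addl.
Qed.

Lemma exec_read_ones e zl k r z3 z4 z5 z6 : not_one r -> k < B ->
  exists zl', exec read_ones
    (e, T7 (inz zl (nseq k (Some true) ++ r)) (wz [::] [::]) (wz [::] [::]) z3 z4 z5 z6)
    (e, T7 (inz zl' r) (wz [::] (nseq k cell0)) (wz [::] (nseq k cell0)) z3 z4 z5 z6).
Proof.
move=> rP kB.
have [|zl' ex] := exec_ones_loop e zl (k := k) (l := [::]) z3 z4 z5 z6 rP.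
  by rewrite addn0.
exists zl'; apply: (ExSeq ex); apply: ExSeq; first exact: rewind1_end.
exact: rewind2_end.
Qed.

Lemma exec_read_hash ok up v e1 e2 e3 e4 zl r zs : exists zl', exec read_hash
  ((ok, up, v, e1, e2, e3, e4), inz zl r :: zs)
  ((ok && is_hash r, up, v, e1, e2, e3, e4),
   inz zl' (if is_hash r then behead r else r) :: zs).
Proof.
case: r => [|[b|] r] /=; rewrite ?andbF ?andbT.
- by exists zl; apply: exec_act.
- by exists zl; apply: exec_act.
- exists (inl None :: zl); apply: exec_act => //=; [exact: zoks0 | by rewrite zacts0].
Qed.

(** Mirrors [row_loop]: after an error the iteration goes on with the flag cleared and nothing
    consumed. *)
Definition read_bit (s : bool * seq bool * seq letter) : bool * seq bool * seq letter :=
  let: (ok, m, r) := s in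
  if r is Some b :: r' then (ok, b :: m, r') else (false, m, r).

Lemma size_read_bit k s : size (iter k read_bit s).1.2 <= k + size s.1.2.
Proof.
elim: k => //= k; case: (iter k _ s) => [[ok m] [|[b|] r]] //= le;
  by rewrite ?(leq_trans le) // ?leq_add2r ?addSn ?ltnS // leqW.
Qed.

Lemma exec_read_row ok up v e1 e2 e3 e4 zl z1 vs l m r z4 z5 z6 :
  size m + size vs < B ->
  let s := iter (size vs) read_bit (ok, m, r) in
  exists zl', exec row_loop
    ((ok, up, v, e1, e2, e3, e4),
     T7 (inz zl r) z1 (wz l vs) (wz (map mc m) [::]) z4 z5 z6)
    ((s.1.1, up, v, e1, e2, e3, e4),
     T7 (inz zl' s.2) z1 (wz (catrev vs l) [::]) (wz (map mc s.1.2) [::]) z4 z5 z6).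
Proof.
elim: vs ok zl l m r => [|x vs IH] ok zl l m r.
  by exists zl; apply: ExWhileF.
rewrite [size (_ :: _)]/= iterSr addnS => lB.
case: r => [|[b|] r].
- have [|zl' ex] := IH false zl (x :: l) m [::]; first exact: ltnW.
  by exists zl'; apply: (ExWhileT _ _ ex) => //; apply: exec_act.
- have [|zl' ex] := IH ok (inl (Some b) :: zl) (x :: l) (b :: m) r.
    by rewrite /= addSn.
  exists zl'; apply: (ExWhileT _ _ ex) => //; apply: exec_act => //=.
  rewrite andbT size_cat !size_map /= addn1.
  by rewrite (leq_trans _ lB) // !ltnS leq_addr.
- have [|zl' ex] := IH false zl (x :: l) m (None :: r); first exact: ltnW.
  by exists zl'; apply: (ExWhileT _ _ ex) => //; apply: exec_act.
Qed.

Lemma exec_matrix_loop ok up v e1 e2 e3 e4 zl us vs l m r z4 z5 z6 :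
  size m + size us * size vs < B ->
  let s := iter (size us * size vs) read_bit (ok, m, r) in
  exists zl', exec matrix_loop
    ((ok, up, v, e1, e2, e3, e4),
     T7 (inz zl r) (wz l us) (wz [::] vs) (wz (map mc m) [::]) z4 z5 z6)
    ((s.1.1, up, v, e1, e2, e3, e4),
     T7 (inz zl' s.2) (wz (catrev us l) [::]) (wz [::] vs)
        (wz (map mc s.1.2) [::]) z4 z5 z6).
Proof.
elim: us ok l zl m r => [|u us IH] ok l zl m r /=.
  by exists zl; apply: ExWhileF.
rewrite mulSn [size vs + _]addnC iterD => lB.
have lB' : size m + size vs < B.
  by apply: leq_ltn_trans lB; rewrite leq_add2l leq_addl.
have [zl1 ex1] := exec_read_row ok up v e1 e2 e3 e4 zl (wz l (u :: us)) [::] r z4 z5 z6 lB'.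
move: (size_read_bit (size vs) (ok, m, r)) ex1 => /=.
case: (iter (size vs) _ _) => [[ok1 m1] r1] /= sz1 ex1.
have [|zl2 ex2] := IH ok1 (u :: l) zl1 m1 r1.
  apply: leq_ltn_trans lB; rewrite [_ * _ + _]addnC addnA leq_add2r.
  by rewrite [size m + _]addnC.
exists zl2; apply: (ExWhileT _ _ ex2) => //.
apply: (ExSeq ex1); apply: ExSeq; first exact: rewind2_end.
exact: exec_act.
Qed.

Lemma exec_read_matrix ok up v e1 e2 e3 e4 zl us vs r z4 z5 z6 :
  size us * size vs < B ->
  let s := iter (size us * size vs) read_bit (ok, [::], r) in
  exists zl', exec read_matrix
    ((ok, up, v, e1, e2, e3, e4),
     T7 (inz zl r) (wz [::] us) (wz [::] vs) (wz [::] [::]) z4 z5 z6)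
    ((s.1.1, up, v, e1, e2, e3, e4),
     T7 (inz zl' s.2) (wz [::] us) (wz [::] vs) (wz [::] (map mc (rev s.1.2))) z4 z5 z6).
Proof.
move=> lB s; have [|zl' ex] := exec_matrix_loop ok up v e1 e2 e3 e4 zl
  (us := us) (vs := vs) [::] (m := [::]) r z4 z5 z6; first by [].
exists zl'; apply: (ExSeq ex); rewrite map_rev.
apply: ExSeq; first exact: rewind1_end.
exact: rewind3.
Qed.

Lemma exec_bits_loop j ok up v e1 e2 e3 e4 zl bs l r zs :
  nth zipper0 zs j = wz l [::] -> j < size zs -> not_bit r -> size bs + size l < B ->
  exists zl', exec (bits_loop j)
    ((ok, up, v, e1, e2, e3, e4), inz zl (map Some bs ++ r) :: zs)
    ((ok, up, v, last e1 bs, e2, e3, e4),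
     inz zl' r :: set_nth zipper0 zs j (wz (catrev (map pc bs) l) [::])).
Proof.
move=> + + rP; elim: bs zl l zs e1 => [|b bs IH] zl l zs e1 zsj ltj lB.
  exists zl => /=; rewrite -zsj (_ : set_nth _ _ _ _ = zs).
    by apply: ExWhileF; case: r rP => [|[b|] r].
  apply: (@eq_from_nth _ zipper0); first by rewrite size_set_nth; apply/maxn_idPr.
  by move=> i _; rewrite nth_set_nth /=; case: eqP => // ->.
have [|||zl' ex] := IH (inl (Some b) :: zl) (pc b :: l)
  (set_nth zipper0 zs j (wz (pc b :: l) [::])) b.
- by rewrite nth_set_nth /= eqxx.
- by rewrite size_set_nth leq_max ltnSn.
- by rewrite /= addnS.
rewrite set_set_nth eqxx in ex.
exists zl'; apply: (ExWhileT _ _ ex) => //; apply: exec_act.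
  rewrite /= zoks_ncons // zsj /= size_cat size_map /= addn1.
  by rewrite (leq_trans _ lB) // !ltnS leq_addl.
by rewrite /= zacts_ncons // zsj.
Qed.

Lemma exec_read_bits j ok up v e1 e2 e3 e4 zl bs r zs :
  nth zipper0 zs j = wz [::] [::] -> j < size zs -> not_bit r -> size bs < B ->
  exists zl', exec (read_bits j)
    ((ok, up, v, e1, e2, e3, e4), inz zl (map Some bs ++ r) :: zs)
    ((ok, up, v, last false bs, e2, e3, e4),
     inz zl' r :: set_nth zipper0 zs j (wz [::] (map pc bs))).
Proof.
move=> zsj ltj rP lB.
have [|zl' ex] := exec_bits_loop ok up v false e2 e3 e4 zl (bs := bs) zsj ltj rP.
  by rewrite addn0.
exists zl'; apply: ExSeq; first exact: exec_act.
apply: (ExSeq ex).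
have := @exec_rewind B j.+1 (ok, up, v, last false bs, e2, e3, e4)
  (inz zl' r :: set_nth zipper0 zs j (wz (rev (map pc bs)) [::]))
  (rev (map pc bs)) [::].
rewrite /= nth_set_nth /= eqxx ltnS size_set_nth leq_max ltnSn.
move=> /(_ isT erefl); rewrite set_set_nth eqxx.
by rewrite -/(rev _) revK.
Qed.

(** * Preparing the time bound and the odometer *)

Lemma exec_copy_loop e z0 us l lt z2 z3 z4 z6 : size us + size lt < B ->
  exec copy_loop (e, T7 z0 (wz l us) z2 z3 z4 (wz lt [::]) z6)
    (e, T7 z0 (wz (catrev us l) [::]) z2 z3 z4
       (wz (catrev (nseq (size us) (pc true)) lt) [::]) z6).
Proof.
elim: us l lt => [|u us IH] l lt /= lB; first exact: ExWhileF.
apply: (ExWhileT _ _ (IH (u :: l) (pc true :: lt) _)) => //=; last by rewrite addnS.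
apply: exec_act => //=; rewrite andbT size_cat size_map /= addn1.
by rewrite (leq_trans _ lB) // !ltnS leq_addl.
Qed.

Lemma exec_copy_time e z0 us z2 z3 z4 z6 : size us < B ->
  exec copy_time (e, T7 z0 (wz [::] us) z2 z3 z4 (wz [::] [::]) z6)
    (e, T7 z0 (wz [::] us) z2 z3 z4 (wz [::] (nseq (size us) (pc true))) z6).
Proof.
move=> lB; apply: ExSeq; first by apply: exec_copy_loop; rewrite addn0.
apply: ExSeq; first exact: rewind1_end.
exact: rewind5_end.
Qed.

Lemma exec_push_loop k e z0 z1 vs l z3 z4 z5 lq : size vs + size lq < B ->
  exec (push_loop k) (e, T7 z0 z1 (wz l vs) z3 z4 z5 (wz lq [::]))
    (e, T7 z0 z1 (wz (catrev vs l) [::]) z3 z4 z5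
       (wz (catrev (nseq (size vs) (qreset k)) lq) [::])).
Proof.
elim: vs l lq => [|v vs IH] l lq /= lB; first exact: ExWhileF.
apply: (ExWhileT _ _ (IH (v :: l) (qreset k :: lq) _)) => //=; last by rewrite addnS.
apply: exec_act => //=; rewrite andbT size_cat size_map /= addn1.
by rewrite (leq_trans _ lB) // !ltnS leq_addl.
Qed.

Lemma catrev_catl (T : Type) (s1 s2 s3 : seq T) :
  catrev (s1 ++ s2) s3 = catrev s2 (catrev s1 s3).
Proof. by rewrite !catrevE rev_cat catA. Qed.

Lemma size_catrev (T : Type) (s1 s2 : seq T) : size (catrev s1 s2) = size s1 + size s2.
Proof. by rewrite catrevE size_cat size_rev. Qed.

Definition quantifiers (n len : nat) : seq bool :=
  nseq n true ++ flatten (nseq len (rcons (nseq n false) true)).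

Lemma exec_levels_loop e z0 z1 vs z3 z4 ts l lq :
  size ts * (size vs).+1 + size lq < B ->
  exec levels_loop (e, T7 z0 z1 (wz [::] vs) z3 z4 (wz l ts) (wz lq [::]))
    (e, T7 z0 z1 (wz [::] vs) z3 z4 (wz (catrev ts l) [::])
       (wz (catrev (map qreset
              (flatten (nseq (size ts) (rcons (nseq (size vs) false) true)))) lq) [::])).
Proof.
elim: ts l lq => [|t ts IH] l lq lB; first exact: ExWhileF.
rewrite /= map_cat catrev_catl.
apply: ExWhileT (IH (t :: l) _ _) => //; last first.
  rewrite /= in lB; rewrite size_catrev size_map size_rcons size_nseq.
  by rewrite addnA [_ + _.+1]addnC -mulSn.
apply: ExSeq; first apply: exec_push_loop.
  by apply: leq_ltn_trans lB; rewrite mulSn leq_add2r (leq_trans _ (leq_addr _ _)).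
apply: ExSeq; first exact: rewind2_end.
rewrite map_rcons -cats1 catrev_catl map_nseq.
apply: exec_act => //=; rewrite andbT size_cat size_map /= addn1 size_catrev size_nseq.
by apply: leq_ltn_trans lB; rewrite mulSn !addSn ltnS leq_add2r leq_addr.
Qed.

Lemma exec_build e z0 z1 vs z3 z4 ts :
  size vs + size ts * (size vs).+1 < B ->
  exec build (e, T7 z0 z1 (wz [::] vs) z3 z4 (wz [::] ts) (wz [::] [::]))
    (e, T7 z0 z1 (wz [::] vs) z3 z4 (wz [::] ts)
       (wz (rev (map qreset (quantifiers (size vs) (size ts)))) [::])).
Proof.
move=> lB; apply: ExSeq; first apply: exec_push_loop.
  by rewrite addn0 (leq_ltn_trans _ lB) // leq_addr.
apply: ExSeq; first exact: rewind2_end.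
rewrite /quantifiers map_cat /rev catrev_catl map_nseq.
apply: ExSeq; last exact: rewind5_end.
by apply: exec_levels_loop; rewrite size_catrev addn0 size_nseq addnC.
Qed.

(** * Passes over the matrix *)

Section Nest.
Variables (S : Type) (g : S -> cell -> bool -> cell -> S * cell).

(** The state type is a parameter because the machine carries all flags, while the analysis keeps
    only those that change: none for a burning step, three for the symmetry test. *)
Fixpoint nrow (u : cell) (e : S) (ms : seq bool) (vs : seq cell) : S * seq cell :=
  match ms, vs with
  | m :: ms', v :: vs' =>
    let r := g e u m v in
    let r' := nrow u r.1 ms' vs' in (r'.1, r.2 :: r'.2)
  | _, _ => (e, [::])
  end.

Fixpoint nrows (us : seq cell) (rows : seq (seq bool)) (e : S) (vs : seq cell) :
    S * seq cell :=
  match us, rows with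
  | u :: us', ms :: rows' =>
    let r := nrow u e ms vs in nrows us' rows' r.1 r.2
  | _, _ => (e, vs)
  end.

Lemma size_nrow u e ms vs : size ms = size vs -> size (nrow u e ms vs).2 = size vs.
Proof. by elim: ms vs e => [|m ms IH] [|v vs] e //= [/IH->]. Qed.

Lemma size_nrows us rows e vs : all (fun ms => size ms == size vs) rows ->
  size (nrows us rows e vs).2 = size vs.
Proof.
elim: us rows e vs => [|u us IH] [|ms rows] e vs //= /andP[/eqP szm szr].
have szv := size_nrow u e szm.
by rewrite IH // szv.
Qed.

End Nest.

Lemma exec_nest_inner g e z0 l1 u us l vs lm ms mr z4 z5 z6 : size ms = size vs ->
  let r := nrow g u e ms vs in
  exec (nest_inner g)
    (e, T7 z0 (wz l1 (u :: us)) (wz l vs) (wz lm (map mc (ms ++ mr))) z4 z5 z6)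
    (r.1, T7 z0 (wz l1 (u :: us)) (wz (catrev r.2 l) [::])
       (wz (catrev (map mc ms) lm) (map mc mr)) z4 z5 z6).
Proof.
elim: vs ms e l lm => [|v vs IH] [|m ms] e l lm //=; first by move=> _; apply: ExWhileF.
move=> [szm]; apply: (ExWhileT _ _ (IH _ _ ((g e u m v).2 :: l) (mc m :: lm) szm)) => //.
exact: exec_act.
Qed.

Lemma exec_nest_outer g e z0 l1 us vs lm rows z4 z5 z6 : size rows = size us ->
  all (fun ms => size ms == size vs) rows ->
  let r := nrows g us rows e vs in
  exec (nest_outer g)
    (e, T7 z0 (wz l1 us) (wz [::] vs) (wz lm (map mc (flatten rows))) z4 z5 z6)
    (r.1, T7 z0 (wz (catrev us l1) [::]) (wz [::] r.2)
       (wz (catrev (map mc (flatten rows)) lm) [::]) z4 z5 z6).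
Proof.
elim: us rows e l1 lm vs => [|u us IH] [|ms rows] e l1 lm vs //.
  by move=> _ _; apply: ExWhileF.
case=> szr /= /andP[/eqP szm szrows].
rewrite map_cat catrev_catl -map_cat.
apply: ExWhileT (IH _ _ (u :: l1) _ _ szr _) => //; last by rewrite (size_nrow g u e szm).
apply: ExSeq; first exact: (exec_nest_inner g e z0 l1 u us [::] lm _ z4 z5 z6 szm).
apply: ExSeq; first exact: rewind2_end.
exact: exec_act.
Qed.

Lemma exec_nest g e z0 us vs rows z4 z5 z6 : size rows = size us ->
  all (fun ms => size ms == size vs) rows ->
  let r := nrows g us rows e vs in
  exec (nest g)
    (e, T7 z0 (wz [::] us) (wz [::] vs) (wz [::] (map mc (flatten rows))) z4 z5 z6)
    (r.1, T7 z0 (wz [::] us) (wz [::] r.2)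
       (wz [::] (map mc (flatten rows))) z4 z5 z6).
Proof.
move=> szr szrows; apply: ExSeq; first exact: exec_nest_outer.
apply: ExSeq; first exact: rewind1_end.
exact: rewind3_end.
Qed.

(** * Evaluation at one assignment *)

Definition qdig (q : cell) : bool * bool := let: (_, b1, b2, _) := q in (b1, b2).
Definition xyc (d : bool * bool) : cell := (d.1, d.2, false, false).

(* Truncating [X] to at most one element lets a loop of the graph be detected as an
   edge from [X] to [X]. *)
Fixpoint keep_first (seen : bool) (ds : seq (bool * bool)) : seq (bool * bool) :=
  if ds is (x, y) :: ds' then (x && ~~ seen, y) :: keep_first (seen || x) ds'
  else [::].

Lemma exec_load_xy_loop ok up v e1 e2 e3 e4 z0 l1 us l vs z3 z4 z5 lq qs qr :
  size us = size vs -> size qs = size vs ->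
  let s := map xyc (keep_first e4 (map qdig qs)) in
  exists e4', exec load_xy_loop
    ((ok, up, v, e1, e2, e3, e4),
     T7 z0 (wz l1 us) (wz l vs) z3 z4 z5 (wz lq (qs ++ qr)))
    ((ok, up, v, e1, e2, e3, e4'),
     T7 z0 (wz (catrev s l1) [::]) (wz (catrev s l) [::]) z3 z4 z5
        (wz (catrev qs lq) qr)).
Proof.
elim: vs us qs e4 l1 l lq => [|x vs IH] [|u us] [|[[[k a] b] acc] qs] e4 l1 l lq //.
  by exists e4; apply: ExWhileF.
case=> szu [szq]; have [e4' ex] := IH us qs (e4 || a)
  (xyc (a && ~~ e4, b) :: l1) (xyc (a && ~~ e4, b) :: l) ((k, a, b, acc) :: lq) szu szq.
by exists e4'; apply: (ExWhileT _ _ ex) => //; apply: exec_act.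
Qed.

Lemma size_keep_first b ds : size (keep_first b ds) = size ds.
Proof. by elim: ds b => [|[x y] ds IH] b //=; rewrite IH. Qed.

Lemma exec_load_xy ok up v e1 e2 e3 e4 z0 us vs z3 z4 z5 lq qs qr :
  size us = size vs -> size qs = size vs ->
  let s := map xyc (keep_first e4 (map qdig qs)) in
  exists e4', exec load_xy
    ((ok, up, v, e1, e2, e3, e4),
     T7 z0 (wz [::] us) (wz [::] vs) z3 z4 z5 (wz lq (qs ++ qr)))
    ((ok, up, v, e1, e2, e3, e4'),
     T7 z0 (wz [::] s) (wz [::] s) z3 z4 z5 (wz (catrev qs lq) qr)).
Proof.
move=> szu szq s; have [e4' ex] := exec_load_xy_loop ok up v e1 e2 e3 e4 z0
  [::] [::] z3 z4 z5 lq qr szu szq.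
exists e4'; apply: (ExSeq ex); apply: ExSeq; first exact: rewind1_end.
exact: rewind2_end.
Qed.

Definition ab_init : cell := (true, false, false, false).

Lemma exec_reset_ab_loop e z0 z1 l vs z3 z4 z5 z6 :
  exec reset_ab_loop (e, T7 z0 z1 (wz l vs) z3 z4 z5 z6)
    (e, T7 z0 z1 (wz (catrev (nseq (size vs) ab_init) l) [::]) z3 z4 z5 z6).
Proof.
elim: vs l => [|v vs IH] l; first exact: ExWhileF.
by apply: (ExWhileT _ _ (IH (ab_init :: l))) => //; apply: exec_act.
Qed.

Lemma exec_reset_ab e z0 z1 vs z3 z4 z5 z6 :
  exec reset_ab (e, T7 z0 z1 (wz [::] vs) z3 z4 z5 z6)
    (e, T7 z0 z1 (wz [::] (nseq (size vs) ab_init)) z3 z4 z5 z6).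
Proof.
apply: ExSeq; first exact: exec_reset_ab_loop.
exact: rewind2_end.
Qed.

Fixpoint pdec (ps : seq cell) : bool * seq cell :=
  if ps is (m, c, _, _) :: ps' then
    if c then (true, (m, false, false, false) :: ps')
    else let r := pdec ps' in (r.1, (m, true, false, false) :: r.2)
  else (false, [::]).

(** The loop stops on the lowest set counter bit, or behind the last bit if none is set. The
    equations describe the tape after the next action has cleared that bit. *)
Lemma exec_borrow_loop e z0 z1 z2 z3 l ps z5 z6 : exists l' r',
  exec borrow_loop (e, T7 z0 z1 z2 z3 (wz l ps) z5 z6)
    (e, T7 z0 z1 z2 z3 (wz l' r') z5 z6) /\
  (if r' is (m, c, _, _) :: r'' then
     [/\ c, (pdec ps).1 &
         catrev l' ((m, false, false, false) :: r'') = catrev l (pdec ps).2]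
   else (pdec ps).1 = false /\ catrev l' [::] = catrev l (pdec ps).2).
Proof.
elim: ps l => [|[[[m []] x] y] ps IH] l.
- by exists l, [::]; split=> //; apply: ExWhileF.
- by exists l, ((m, true, x, y) :: ps); split=> //; apply: ExWhileF.
- have [l' [r' [ex lr]]] := IH ((m, true, false, false) :: l).
  exists l', r'; split=> //.
  by apply: (ExWhileT _ _ ex) => //; apply: exec_act.
Qed.

Lemma exec_decrement ok up v e1 e2 e3 e4 z0 z1 z2 z3 ps z5 z6 :
  exec decrement
    ((ok, up, v, e1, e2, e3, e4), T7 z0 z1 z2 z3 (wz [::] ps) z5 z6)
    ((ok, up, v && (pdec ps).1, e1, e2, e3, e4),
     T7 z0 z1 z2 z3 (wz [::] (pdec ps).2) z5 z6).
Proof.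
have [l' [r' [ex]]] := exec_borrow_loop (ok, up, v, e1, e2, e3, e4) z0 z1 z2 z3
  [::] ps z5 z6.
case: r' ex => [|[[[m c] x] y] r'] ex.
  case=> -> pE; rewrite andbF; apply: (ExSeq ex); apply: ExSeq.
    by apply: exec_act.
  by rewrite -[(pdec ps).2]pE; apply: rewind4.
case=> _ -> pE; rewrite andbT; apply: (ExSeq ex).
apply: (@ExSeq _ _ _ _ _ _ ((ok, up, v, e1, e2, e3, e4),
   T7 z0 z1 z2 z3 (wz l' ((m, false, false, false) :: r')) z5 z6)).
  exact: exec_act.
by rewrite -[(pdec ps).2]pE; apply: rewind4.
Qed.

Fixpoint pdecs (ps : seq cell) (fs : seq bool) : bool * seq cell :=
  if fs is f :: fs' then
    if f then let r := pdec ps in let r' := pdecs r.2 fs' in (r.1 && r'.1, r'.2)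
    else pdecs ps fs'
  else (true, ps).

Fixpoint load_u (vs : seq cell) (ds : seq (bool * bool)) : seq cell :=
  match vs, ds with
  | (a, _, _, _) :: vs', (f, _) :: ds' =>
    (a && ~~ f, false, false, false) :: load_u vs' ds'
  | _, _ => [::]
  end.

Fixpoint load_v (t : bool) (vs : seq cell) (ds : seq (bool * bool)) : seq cell :=
  match vs, ds with
  | (a, b, _, _) :: vs', (f, c) :: ds' =>
    (if t then a && ~~ f else a, b, c, false) :: load_v t vs' ds'
  | _, _ => [::]
  end.

Lemma exec_load_fc_loop ok up v t e2 e3 e4 z0 l1 us l vs z3 ps z5 lq qs qr :
  size us = size vs -> size qs = size vs ->
  let ds := map qdig qs in
  let r := pdecs ps [seq t && d.1 | d <- ds] in
  exec load_fc_loop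
    ((ok, up, v, t, e2, e3, e4),
     T7 z0 (wz l1 us) (wz l vs) z3 (wz [::] ps) z5 (wz lq (qs ++ qr)))
    ((ok, up, v && r.1, t, e2, e3, e4),
     T7 z0 (wz (catrev (load_u vs ds) l1) [::])
        (wz (catrev (load_v t vs ds) l) [::]) z3 (wz [::] r.2) z5
        (wz (catrev qs lq) qr)).
Proof.
elim: vs us qs v ps l1 l lq =>
    [|[[[a b] x] y] vs IH] [|u us] [|[[[k f] c] acc] qs] v ps l1 l lq //.
  by move=> _ _; rewrite /= andbT; apply: ExWhileF.
case=> szu [szq] ds r.
set ps1 := if t && f then (pdec ps).2 else ps.
set v1 := if t && f then v && (pdec ps).1 else v.
have -> : v && r.1 = v1 && (pdecs ps1 [seq t && d.1 | d <- map qdig qs]).1.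
  by rewrite /r /ds /v1 /ps1 /=; case: (t && f); rewrite //= andbA.
have -> : r.2 = (pdecs ps1 [seq t && d.1 | d <- map qdig qs]).2.
  by rewrite /r /ds /v1 /ps1 /=; case: (t && f).
apply: (ExWhileT _ _ (IH us qs v1 ps1 ((a && ~~ f, false, false, false) :: l1)
  ((if t then a && ~~ f else a, b, c, false) :: l) ((k, f, c, acc) :: lq) szu szq)) => //.
apply: (@ExSeq _ _ _ _ _ _ ((ok, up, v1, t, e2, e3, e4),
   T7 z0 (wz l1 (u :: us)) (wz l ((a, b, x, y) :: vs)) z3 (wz [::] ps1) z5
     (wz lq ((k, f, c, acc) :: qs ++ qr)))); last exact: exec_act.
apply: ExIf; rewrite /= /v1 /ps1; case: (t && f); last exact: exec_act.
exact: exec_decrement.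
Qed.

Lemma exec_load_fc ok up v t e2 e3 e4 z0 us vs z3 ps z5 lq qs qr :
  size us = size vs -> size qs = size vs ->
  let ds := map qdig qs in
  let r := pdecs ps [seq t && d.1 | d <- ds] in
  exec load_fc
    ((ok, up, v, t, e2, e3, e4),
     T7 z0 (wz [::] us) (wz [::] vs) z3 (wz [::] ps) z5 (wz lq (qs ++ qr)))
    ((ok, up, v && r.1, t, e2, e3, e4),
     T7 z0 (wz [::] (load_u vs ds)) (wz [::] (load_v t vs ds)) z3 (wz [::] r.2) z5
        (wz (catrev qs lq) qr)).
Proof.
move=> szu szq ds r; apply: ExSeq; first exact: exec_load_fc_loop.
apply: ExSeq; first exact: rewind1_end.
exact: rewind2_end.
Qed.

Definition choose (ch : bool) (x : cell) : cell :=
  let: (a, b, c, _) := x in if ch then (c, b, c, false) else (a, c, c, false).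

Lemma exec_choose_loop ok up v e1 ch e3 e4 z0 z1 l vs z3 z4 z5 z6 :
  exec choose_loop
    ((ok, up, v, e1, ch, e3, e4), T7 z0 z1 (wz l vs) z3 z4 z5 z6)
    ((ok, up, v, e1, ch, e3, e4),
     T7 z0 z1 (wz (catrev (map (choose ch) vs) l) [::]) z3 z4 z5 z6).
Proof.
elim: vs l => [|[[[a b] c] d] vs IH] l; first exact: ExWhileF.
by apply: (ExWhileT _ _ (IH (choose ch (a, b, c, d) :: l))) => //; apply: exec_act.
Qed.

Lemma exec_choose_half ok up v e1 ch e3 e4 z0 z1 vs z3 z4 z5 z6 :
  exec choose_half
    ((ok, up, v, e1, ch, e3, e4), T7 z0 z1 (wz [::] vs) z3 z4 z5 z6)
    ((ok, up, v, e1, ch, e3, e4), T7 z0 z1 (wz [::] (map (choose ch) vs)) z3 z4 z5 z6).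
Proof.
apply: ExSeq; first exact: exec_choose_loop.
exact: rewind2_end.
Qed.

Definition pm (p : cell) : bool := let: (m, _, _, _) := p in m.

Lemma exec_counter_loop e z0 z1 z2 z3 l ps z5 z6 :
  exec counter_loop (e, T7 z0 z1 z2 z3 (wz l ps) z5 z6)
    (e, T7 z0 z1 z2 z3 (wz (catrev (map pc (map pm ps)) l) [::]) z5 z6).
Proof.
elim: ps l => [|[[[m c] x] y] ps IH] l; first exact: ExWhileF.
by apply: (ExWhileT _ _ (IH (pc m :: l))) => //; apply: exec_act.
Qed.

Lemma exec_reset_counter e z0 z1 z2 z3 ps z5 z6 :
  exec reset_counter (e, T7 z0 z1 z2 z3 (wz [::] ps) z5 z6)
    (e, T7 z0 z1 z2 z3 (wz [::] (map pc (map pm ps))) z5 z6).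
Proof.
apply: ExSeq; first exact: exec_counter_loop.
exact: rewind4_end.
Qed.

Lemma map_pm_pdec ps : map pm (pdec ps).2 = map pm ps.
Proof. by elim: ps => [|[[[m []] x] y] ps IH] //=; rewrite IH. Qed.

Lemma map_pm_pdecs ps fs : map pm (pdecs ps fs).2 = map pm ps.
Proof. by elim: fs ps => [|[] fs IH] ps //=; rewrite IH // map_pm_pdec. Qed.

Definition gstep (t : bool) (e : unit) (u : cell) (m : bool) (x : cell) : unit * cell :=
  let: (ux, _, _, _) := u in
  let: (a, b, c, d) := x in (e, (a || [&& t, ux & m], b, c, d)).

Lemma nrows_glev ok up v t e2 e3 e4 us rows vs :
  nrows glev us rows (ok, up, v, t, e2, e3, e4) vs =
  ((ok, up, v, t, e2, e3, e4), (nrows (gstep t) us rows tt vs).2).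
Proof.
have nrowE u ms ws : nrow glev u (ok, up, v, t, e2, e3, e4) ms ws =
    ((ok, up, v, t, e2, e3, e4), (nrow (gstep t) u tt ms ws).2).
  elim: ms ws => [|m ms IH] [|[[[a b] c] d] ws] //=.
  by case: u IH => [[[ux uy] x] y] /= ->.
elim: us rows vs => [|u us IH] [|ms rows] vs //=.
by rewrite nrowE IH; case: (nrow (gstep t) u tt ms vs) => -[].
Qed.

Lemma size_load_u vs ds : size vs = size ds -> size (load_u vs ds) = size vs.
Proof. by elim: vs ds => [|[[[a b] c] d] vs IH] [|[f e] ds] //= [/IH->]. Qed.

Lemma size_load_v t vs ds : size vs = size ds -> size (load_v t vs ds) = size vs.
Proof. by elim: vs ds => [|[[[a b] c] d] vs IH] [|[f e] ds] //= [/IH->]. Qed.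

Definition level_v (t ch : bool) (rows : seq (seq bool)) (vs : seq cell)
    (ds : seq (bool * bool)) : seq cell :=
  map (choose ch) (nrows (gstep t) (load_u vs ds) rows tt (load_v t vs ds)).2.

Lemma size_level_v t ch rows vs ds : size vs = size ds ->
  all (fun ms => size ms == size vs) rows -> size (level_v t ch rows vs ds) = size vs.
Proof.
by move=> szd szr; rewrite size_map size_nrows size_load_v.
Qed.

Lemma exec_level ok up v t e1 e2 e3 e4 z0 us vs rows mb lt tr lq qs q qr :
  size us = size vs -> size qs = size vs -> size rows = size vs ->
  all (fun ms => size ms == size vs) rows ->
  let ds := map qdig qs in
  exists e1' e2', exec level
    ((ok, up, v, e1, e2, e3, e4),
     T7 z0 (wz [::] us) (wz [::] vs) (wz [::] (map mc (flatten rows)))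
        (wz [::] (map pc mb)) (wz lt (pc t :: tr)) (wz lq (qs ++ q :: qr)))
    ((ok, up, v && (pdecs (map pc mb) [seq t && d.1 | d <- ds]).1, e1', e2', e3, e4),
     T7 z0 (wz [::] (load_u vs ds)) (wz [::] (level_v t (qdig q).1 rows vs ds))
        (wz [::] (map mc (flatten rows))) (wz [::] (map pc mb))
        (wz (pc t :: lt) tr) (wz (q :: catrev qs lq) qr)).
Proof.
move=> szu szq szr szrows ds; exists t, (qdig q).1.
have szd : size vs = size ds by rewrite size_map szq.
apply: (@ExSeq _ _ _ _ _ _ ((ok, up, v, t, e2, e3, e4),
     T7 z0 (wz [::] us) (wz [::] vs) (wz [::] (map mc (flatten rows)))
        (wz [::] (map pc mb)) (wz (pc t :: lt) tr) (wz lq (qs ++ q :: qr)))).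
  exact: exec_act.
apply: ExSeq; first exact: exec_load_fc.
apply: ExSeq; first apply: (exec_nest glev).
- by rewrite size_load_u.
- by rewrite size_load_v.
rewrite nrows_glev.
set ws := (nrows (gstep t) _ _ _ _).2.
set v' := v && _.
set ps := (pdecs _ _).2.
apply: (@ExSeq _ _ _ _ _ _ ((ok, up, v', t, (qdig q).1, e3, e4),
     T7 z0 (wz [::] (load_u vs ds)) (wz [::] ws) (wz [::] (map mc (flatten rows)))
        (wz [::] ps) (wz (pc t :: lt) tr) (wz (q :: catrev qs lq) qr))).
  by case: (q) => [[[k b1] b2] acc]; apply: exec_act.
apply: ExSeq; first exact: exec_choose_half.
(* Decrements touch only the counter bits; the bits of [m] survive, and the counter is restored from
   them. *)
have -> : map pc mb = map pc (map pm ps).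
  by rewrite map_pm_pdecs -[map pm _]map_comp map_id.
exact: exec_reset_counter.
Qed.

(** Digits are consumed in blocks of [(size vs).+1]: one per vertex for F and C, then the one whose
    first bit chooses the half. *)
Fixpoint levels (rows : seq (seq bool)) (mb tb : seq bool) (v : bool)
    (vs : seq cell) (ds : seq (bool * bool)) : bool * seq cell :=
  if tb is t :: tb' then
    let dl := take (size vs) ds in
    levels rows mb tb' (v && (pdecs (map pc mb) [seq t && d.1 | d <- dl]).1)
      (level_v t (nth (false, false) ds (size vs)).1 rows vs dl)
      (drop (size vs).+1 ds)
  else (v, vs).

Lemma exec_levels ok up v e1 e2 e3 e4 z0 us vs rows mb lt tb lq qs :
  size us = size vs -> size rows = size vs ->
  all (fun ms => size ms == size vs) rows ->
  size qs = size tb * (size vs).+1 ->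
  let r := levels rows mb tb v vs (map qdig qs) in
  exists e1' e2' us', [/\ size us' = size vs, size r.2 = size vs &
    exec (While (nonblank 5) level)
    ((ok, up, v, e1, e2, e3, e4),
     T7 z0 (wz [::] us) (wz [::] vs) (wz [::] (map mc (flatten rows)))
        (wz [::] (map pc mb)) (wz lt (map pc tb)) (wz lq qs))
    ((ok, up, r.1, e1', e2', e3, e4),
     T7 z0 (wz [::] us') (wz [::] r.2) (wz [::] (map mc (flatten rows)))
        (wz [::] (map pc mb)) (wz (catrev (map pc tb) lt) [::])
        (wz (catrev qs lq) [::]))].
Proof.
elim: tb v e1 e2 us vs lt lq qs => [|t tb IH] v e1 e2 us vs lt lq qs szu szr szrows.
  by case: qs => // _; exists e1, e2, us; split=> //; apply: ExWhileF.
rewrite /= mulSn => szq.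
have szq1 : size (take (size vs) qs) = size vs.
  by rewrite size_take_min; apply/minn_idPl; rewrite szq addSn ltnW // ltnS leq_addr.
have [q [qr dqs]] : exists q qr, drop (size vs) qs = q :: qr.
  case: (drop _ _) (size_drop (size vs) qs) => [|q qr _]; last by exists q, qr.
  by rewrite szq addSn -addnS addKn.
have qsE : qs = take (size vs) qs ++ q :: qr by rewrite -dqs cat_take_drop.
set ql := take _ _ in szq1 qsE.
have szqr : size qr = size tb * (size vs).+1.
  by apply/eqP; rewrite -(eqn_add2l (size vs).+1) -szq [in X in _ == X]qsE
     size_cat /= szq1 addSnnS.
have qsd : map qdig qs = map qdig ql ++ qdig q :: map qdig qr.
  by rewrite [in LHS]qsE map_cat.
have szql : size (map qdig ql) = size vs by rewrite size_map.
rewrite qsd take_size_cat // nth_cat szql ltnn subnn /=.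
rewrite -[(size vs).+1]addn1 addnC -drop_drop drop_size_cat // /= drop0.
have [e1' [e2' ex]] := exec_level ok up v t e1 e2 e3 e4 z0 mb lt (map pc tb) lq q qr
  szu szq1 szr szrows.
set v1 := v && _ in ex *; set vs1 := level_v _ _ _ _ _ in ex *.
have szv1 : size vs1 = size vs by rewrite size_level_v.
have [||||e1'' [e2'' [us' [szu' szr' ex']]]] :=
  IH v1 e1' e2' (load_u vs (map qdig ql)) vs1 (pc t :: lt) (q :: catrev ql lq) qr.
- by rewrite szv1 size_load_u.
- by rewrite szv1.
- by rewrite szv1.
- by rewrite szv1.
exists e1'', e2'', us'; split; rewrite ?szr' ?szu' //.
by rewrite qsE catrev_catl; apply: (ExWhileT _ _ ex').
Qed.

Definition sub_ab (x : cell) : bool := let: (a, b, _, _) := x in a ==> b.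

Lemma exec_subset_loop ok up v e1 e2 e3 e4 z0 z1 l vs z3 z4 z5 z6 :
  exec subset_loop
    ((ok, up, v, e1, e2, e3, e4), T7 z0 z1 (wz l vs) z3 z4 z5 z6)
    ((ok, up, v && all sub_ab vs, e1, e2, e3, e4),
     T7 z0 z1 (wz (catrev vs l) [::]) z3 z4 z5 z6).
Proof.
elim: vs v l => [|[[[a b] c] d] vs IH] v l; first by rewrite andbT; apply: ExWhileF.
rewrite /= andbA.
by apply: (ExWhileT _ _ (IH _ ((a, b, c, d) :: l))) => //; apply: exec_act.
Qed.

Lemma exec_check_subset ok up v e1 e2 e3 e4 z0 z1 vs z3 z4 z5 z6 :
  exec check_subset
    ((ok, up, v, e1, e2, e3, e4), T7 z0 z1 (wz [::] vs) z3 z4 z5 z6)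
    ((ok, up, v && all sub_ab vs, e1, e2, e3, e4),
     T7 z0 z1 (wz [::] vs) z3 z4 z5 z6).
Proof.
apply: ExSeq; first exact: exec_subset_loop.
exact: rewind2_end.
Qed.

Definition gcheck (e : bool * bool * bool) (u : cell) (m : bool) (x : cell) :
    (bool * bool * bool) * cell :=
  let: (e1, e2, e3) := e in
  let: (ux, uy, _, _) := u in
  let: (vx, vy, _, _) := x in
  ((e1 || [&& ux, m & vy], e2 || [&& uy, m & vx], e3 || [&& ux, m & vx]), x).

Lemma nrows_gsym ok up v e e4 us rows vs :
  nrows gsym us rows (ok, up, v, e.1.1, e.1.2, e.2, e4) vs =
  let r := nrows gcheck us rows e vs in
  ((ok, up, v, r.1.1.1, r.1.1.2, r.1.2, e4), r.2).
Proof.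
have nrowE u ms ws e' : nrow gsym u (ok, up, v, e'.1.1, e'.1.2, e'.2, e4) ms ws =
    let r := nrow gcheck u e' ms ws in
    ((ok, up, v, r.1.1.1, r.1.1.2, r.1.2, e4), r.2).
  elim: ms ws e' => [|m ms IH] [|[[[a b] c] d] ws] e' //.
  case: u IH e' => [[[ux uy] x] y] IH [[e1 e2] e3] /=.
  by rewrite (IH ws (e1 || [&& ux, m & b], e2 || [&& uy, m & a], e3 || [&& ux, m & a])).
elim: us rows vs e => [|u us IH] [|ms rows] vs e //.
by rewrite /= nrowE IH.
Qed.

Definition sym_check (rows : seq (seq bool)) (xy : seq (bool * bool)) : bool :=
  let s := map xyc (keep_first false xy) in
  let: (e1, e2, e3) := (nrows gcheck s rows (false, false, false) s).1 in
  (e1 == e2) && ~~ e3.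

Definition leaf_value (n : nat) (rows : seq (seq bool)) (mb tb : seq bool)
    (ds : seq (bool * bool)) : bool :=
  let r := levels rows mb tb (sym_check rows (take n ds)) (nseq n ab_init) (drop n ds) in
  r.1 && all sub_ab r.2.

Lemma exec_leaf ok up v e1 e2 e3 e4 z0 us vs rows mb tb lq rq :
  size us = size vs -> size rows = size vs ->
  all (fun ms => size ms == size vs) rows ->
  size (catrev lq rq) = size vs + size tb * (size vs).+1 ->
  exists e1' e2' e3' e4' us' vs', [/\ size us' = size vs, size vs' = size vs &
    exec leaf
    ((ok, up, v, e1, e2, e3, e4),
     T7 z0 (wz [::] us) (wz [::] vs) (wz [::] (map mc (flatten rows)))
        (wz [::] (map pc mb)) (wz [::] (map pc tb)) (wz lq rq))
    ((ok, true, leaf_value (size vs) rows mb tb (map qdig (catrev lq rq)),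
      e1', e2', e3', e4'),
     T7 z0 (wz [::] us') (wz [::] vs') (wz [::] (map mc (flatten rows)))
        (wz [::] (map pc mb)) (wz [::] (map pc tb)) (wz (rev (catrev lq rq)) [::]))].
Proof.
move=> szu szr szrows; set qs := catrev lq rq => szq.
have szqx : size (take (size vs) qs) = size vs.
  by rewrite size_take_min; apply/minn_idPl; rewrite szq leq_addr.
have szqd : size (drop (size vs) qs) = size tb * (size vs).+1.
  by rewrite size_drop szq addKn.
pose xy := map xyc (keep_first false (map qdig (take (size vs) qs))).
have szxy : size xy = size vs by rewrite size_map size_keep_first size_map.
have szrows' : all (fun ms => size ms == size xy) rows by rewrite szxy.
have [e4' exL] := exec_load_xy ok up v false false false false z0
  (wz [::] (map mc (flatten rows))) (wz [::] (map pc mb)) (wz [::] (map pc tb)) [::]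
  (drop (size vs) qs) szu szqx.
have exN := exec_nest gsym (ok, up, v, false, false, false, e4') z0
  (wz [::] (map pc mb)) (wz [::] (map pc tb))
  (wz (catrev (take (size vs) qs) [::]) (drop (size vs) qs))
  (etrans szr (esym szxy)) szrows'.
have := nrows_gsym ok up v (false, false, false) e4' xy rows xy.
move: exN (size_nrows gcheck xy (false, false, false) szrows') => /= exN szx xE.
rewrite {}xE in exN.
set ws := (nrows gcheck _ _ _ _).2 in exN szx.
have szi : size (nseq (size vs) ab_init) = size vs by rewrite size_nseq.
have [||||] := exec_levels ok up (sym_check rows (take (size vs) (map qdig qs)))
  (nrows gcheck xy rows (false, false, false) xy).1.1.1
  (nrows gcheck xy rows (false, false, false) xy).1.1.2
  (nrows gcheck xy rows (false, false, false) xy).1.2 e4' z0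
  (us := xy) (vs := nseq (size vs) ab_init) (rows := rows) mb [::] (tb := tb)
  (catrev (take (size vs) qs) [::]) (qs := drop (size vs) qs).
- by rewrite szi.
- by rewrite szi.
- by rewrite szi.
- by rewrite szi.
move=> e1' [e2' [us' [szu' szv']]].
rewrite -catrev_catl cat_take_drop map_drop => ex.
rewrite szi ?map_drop in szu' szv'.
do 6!eexists; split; first exact: szu'; first exact: szv'.
apply: ExSeq; first exact: rewind6.
apply: ExSeq; first exact: exec_act.
rewrite -/qs -[qs in (wz [::] qs)](cat_take_drop (size vs)).
apply: (ExSeq exL); apply: (ExSeq exN).
apply: ExSeq; first exact: exec_act.
apply: ExSeq; first exact: exec_reset_ab.
rewrite szx szxy; apply: ExSeq.
  rewrite /= (_ : _ && _ = sym_check rows (take (size vs) (map qdig qs))).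
    exact: ex.
  by rewrite /sym_check -map_take -/xy; case: (nrows _ _ _ _ _) => -[[]].
apply: ExSeq; first exact: rewind5_end.
apply: ExSeq; first exact: exec_check_subset.
exact: exec_act.
Qed.

(* The quantifier [k] is universal if [k = true]; [k] is then also the unit of the
   connective. *)
Fixpoint evalq (ks : seq bool) (f : seq (bool * bool) -> bool) : bool :=
  if ks is k :: ks' then
    let o := if k then andb else orb in
    let r d := evalq ks' (fun s => f (d :: s)) in
    o (o (o (o k (r (false, false))) (r (false, true))) (r (true, false)))
      (r (true, true))
  else f [::].

Lemma eq_evalq ks f g : f =1 g -> evalq ks f = evalq ks g.
Proof.
elim: ks f g => [|k ks IH] f g fg /=; first exact: fg.
have E d : evalq ks (fun s => f (d :: s)) = evalq ks (fun s => g (d :: s)).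
  by apply: IH => s; apply: fg.
by rewrite !E.
Qed.

(** * The odometer evaluates the quantified formula *)

Definition fval (e : flags) : bool :=
  let: (ok, up, v, e1, e2, e3, e4) := e in v.

(** Speaks of the rest of the run only. This allows a continuation style: a subformula is evaluated
    given what happens once the carry leaves its digits. *)
Definition odometer_yields (s : store symbol flags) (b : bool) : Prop :=
  exists s', exec odometer s s' /\ fval s'.1 = b.

Lemma odometer_step (s s1 : store symbol flags) b :
  (let: (ok, up, v, e1, e2, e3, e4) := s.1 in
   ok /\ exec (if up then carry else leaf) s s1) ->
  odometer_yields s1 b -> odometer_yields s b.
Proof.
case: s => [[[[[[[ok up] v] e1] e2] e3] e4] zs] /= [okT ex] [s' [ex' vE]].
exists s'; split=> //; apply: ExWhileT ex' => //.
by apply: ExIf.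
Qed.

Section Odometer.
Variables (n : nat) (rows : seq (seq bool)) (mb tb : seq bool).
Hypotheses (szr : size rows = n) (szrows : all (fun ms => size ms == n) rows).
Local Notation lv := (leaf_value n rows mb tb).

Definition ostore z0 us vs lq rq : seq (zipper symbol) :=
  T7 z0 (wz [::] us) (wz [::] vs) (wz [::] (map mc (flatten rows)))
     (wz [::] (map pc mb)) (wz [::] (map pc tb)) (wz lq rq).

Lemma carry_digit v e1 e2 e3 e4 z0 us vs p k b1 b2 acc r b :
  let v' := (if k then andb else orb) acc v in
  odometer_yields
    (if b1 && b2 then ((true, true, v', e1, e2, e3, e4),
                       ostore z0 us vs (rev p) (qreset k :: r))
     else ((true, false, v, e1, e2, e3, e4),
           ostore z0 us vs (rev p) ((k, b1 || b2, ~~ b2, v') :: r))) b ->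
  odometer_yields
    ((true, true, v, e1, e2, e3, e4),
     ostore z0 us vs (rev (rcons p (k, b1, b2, acc))) r) b.
Proof.
move=> v' H; apply: odometer_step H => /=; split=> //; rewrite rev_rcons.
apply: (@ExSeq _ _ _ _ _ _ ((true, true, v, e1, e2, e3, e4),
  ostore z0 us vs (rev p) ((k, b1, b2, acc) :: r))).
  by case: r => [|x r]; apply: exec_act.
apply: exec_act; rewrite /= /v'; first by case: (b1 && b2).
by case: (b1 && b2); case: (k).
Qed.

(** Induction on the digits [ks] to the right of the fixed prefix [p]. The last premise is the
    continuation, entered when all digits of [ks] are reset and a carry bearing the value of the
    subformula reaches [p]. Scratch flags and vectors are generalized since each leaf changes
    them. *)
Lemma odometer_evalq ks p v e1 e2 e3 e4 z0 us vs lq rq b :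
  size us = n -> size vs = n -> size p + size ks = n + size tb * n.+1 ->
  catrev lq rq = p ++ map qreset ks ->
  (forall e1 e2 e3 e4 us vs, size us = n -> size vs = n ->
     odometer_yields
       ((true, true, evalq ks (fun s => lv (map qdig p ++ s)), e1, e2, e3, e4),
        ostore z0 us vs (rev p) (map qreset ks)) b) ->
  odometer_yields ((true, false, v, e1, e2, e3, e4), ostore z0 us vs lq rq) b.
Proof.
elim: ks p v e1 e2 e3 e4 us vs lq rq => [|k ks IH] p v e1 e2 e3 e4 us vs lq rq szu szv szp qE H.
  have [||||] := @exec_leaf true false v e1 e2 e3 e4 z0 us vs rows mb tb lq rq.
  - by rewrite szu szv.
  - by rewrite szv.
  - by rewrite szv.
  - by rewrite qE cats0 szv; rewrite addn0 in szp.
  move=> e1' [e2' [e3' [e4' [us' [vs' [szu' szv' ex]]]]]].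
  rewrite szv in szu' szv' ex.
  apply: (@odometer_step _ _ _ _ (H e1' e2' e3' e4' us' vs' szu' szv')) => /=.
  by rewrite qE /= !cats0 in ex *; split.
have size_p d : size (rcons p d) + size ks = n + size tb * n.+1.
  by rewrite size_rcons addSnnS.
have start d : catrev (rev p) (d :: map qreset ks) = rcons p d ++ map qreset ks.
  by rewrite catrevE revK cat_rcons.
have dig k' b1 b2 acc :
    evalq ks (fun s => lv (map qdig (rcons p (k', b1, b2, acc)) ++ s)) =
    evalq ks (fun s => lv (map qdig p ++ (b1, b2) :: s)).
  by apply: eq_evalq => s; rewrite map_rcons cat_rcons.
(* Four rounds, for the digit values 00, 01, 10, 11: the induction hypothesis evaluates the rest,
   and the carry that follows folds the value into the partial result. *)
apply: (IH (rcons p (qreset k))) => //; first by rewrite cat_rcons.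
move=> {}e1 {}e2 {}e3 {}e4 {szu szv}us {}vs szu szv.
rewrite dig; apply: carry_digit => /=.
apply: (IH _ _ _ _ _ _ _ _ _ _ _ _ _ (start _)) => // {}e1 {}e2 {}e3 {}e4 {szu szv}us {}vs szu szv.
rewrite dig; apply: carry_digit => /=.
apply: (IH _ _ _ _ _ _ _ _ _ _ _ _ _ (start _)) => // {}e1 {}e2 {}e3 {}e4 {szu szv}us {}vs szu szv.
rewrite dig; apply: carry_digit => /=.
apply: (IH _ _ _ _ _ _ _ _ _ _ _ _ _ (start _)) => // {}e1 {}e2 {}e3 {}e4 {szu szv}us {}vs szu szv.
rewrite dig; apply: carry_digit => /=.
exact: H.
Qed.

Lemma exec_odometer v e1 e2 e3 e4 z0 us vs :
  size us = n -> size vs = n ->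
  odometer_yields ((true, false, v, e1, e2, e3, e4),
      ostore z0 us vs (rev (map qreset (quantifiers n (size tb)))) [::])
    (evalq (quantifiers n (size tb)) lv).
Proof.
move=> szu szv; apply: (@odometer_evalq (quantifiers n (size tb)) [::]) => //.
- rewrite add0n /quantifiers size_cat size_nseq; congr (_ + _).
  by elim: (size tb) => //= len IH; rewrite size_cat size_rcons size_nseq IH mulSn.
- by rewrite -/(rev _) revK.
move=> {}e1 {}e2 {}e3 {}e4 {szu szv}us {}vs szu szv.
set val := evalq _ _.
exists ((false, true, val, e1, e2, e3, e4), T7 z0 (wz [::] us) (wz [::] vs)
  (wz [::] (map mc (flatten rows))) (wz [::] (map pc mb)) (wz [::] (map pc tb))
  ([::], marker :: map data (map qreset (quantifiers n (size tb))))); split; last first.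
  by rewrite /val; apply: eq_evalq.
apply: ExWhileT; [by [] | | exact: ExWhileF].
apply: ExIf; apply: (@ExSeq _ _ _ _ _ _ ((true, true, val, e1, e2, e3, e4),
  T7 z0 (wz [::] us) (wz [::] vs)
  (wz [::] (map mc (flatten rows))) (wz [::] (map pc mb)) (wz [::] (map pc tb))
  ([::], marker :: map data (map qreset (quantifiers n (size tb)))))).
  by case: (map qreset _) => [|x qs]; apply: exec_act.
exact: exec_act.
Qed.

End Odometer.

(** * Unique readability of the input *)

Lemma split_ones (w : seq letter) : exists k r, w = nseq k (Some true) ++ r /\ not_one r.
Proof.
elim: w => [|[[]|] w [k [r [-> rP]]]]; first by exists 0, [::].
- by exists k.+1, r.
- by exists 0, (Some false :: nseq k (Some true) ++ r).
- by exists 0, (None :: nseq k (Some true) ++ r).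
Qed.

Lemma split_bits (w : seq letter) : exists bs r, w = map Some bs ++ r /\ not_bit r.
Proof.
elim: w => [|[b|] w [bs [r [-> rP]]]]; first by exists [::], [::].
- by exists (b :: bs), r.
- by exists [::], (None :: map Some bs ++ r).
Qed.

Lemma split_ones_inj k k' (r r' : seq letter) : not_one r -> not_one r' ->
  nseq k (Some true) ++ r = nseq k' (Some true) ++ r' -> k = k' /\ r = r'.
Proof.
move=> rP rP'; elim: k k' => [|k IH] [|k'] //= E.
- by move: rP; rewrite E.
- by move: rP'; rewrite -E.
- by case: E => /IH[-> ->].
Qed.

Lemma split_bits_inj (bs bs' : seq bool) (r r' : seq letter) : not_bit r -> not_bit r' ->
  map Some bs ++ r = map Some bs' ++ r' -> bs = bs' /\ r = r'.
Proof.
move=> rP rP'; elim: bs bs' => [|b bs IH] [|b' bs'] //= E.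
- by move: rP; rewrite E.
- by move: rP'; rewrite -E.
- by case: E => -> /IH[-> ->].
Qed.

Lemma read_bit_ok k ok m r : (iter k read_bit (ok, m, r)).1.1 ->
  ok /\ exists2 s, size s = k &
    r = map Some s ++ (iter k read_bit (ok, m, r)).2 /\
    (iter k read_bit (ok, m, r)).1.2 = catrev s m.
Proof.
elim: k ok m r => [|k IH] ok m r; first by move=> okT; split=> //; exists [::].
rewrite iterSr; case: r => [|[b|] r].
- by case/IH.
- case/IH=> okT [s szs [rE mE]]; split=> //; exists (b :: s); first by rewrite /= szs.
  by rewrite /= -rE.
- by case/IH.
Qed.

Lemma read_bits_cat ok m (s : seq bool) r :
  iter (size s) read_bit (ok, m, map Some s ++ r) = (ok, catrev s m, r).
Proof. by elim: s ok m => // b s IH ok m; rewrite [size _]/= iterSr IH. Qed.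

Lemma size_iter_read_bit k s : size (iter k read_bit s).2 <= size s.2.
Proof.
by elim: k => //= k; case: (iter k _ s) => [[ok m] [|[b|] r]] //= /ltnW.
Qed.

(** * The complete run *)

(** Purely syntactic: that the matrix is symmetric and irreflexive is left to the formula. *)
Definition parsed (timed : bool) (w : seq letter) (n : nat) (mat mb tb : seq bool) : Prop :=
  [/\ w = bits (nseq n true) ++ None :: bits mat ++ None :: bits mb
          ++ (if timed then None :: bits tb else [::]),
      size mat = n * n, last false mb &
      if timed then is_true (last false tb) else tb = nseq n true].

Lemma exec_mark_tapes e w : 0 < B ->
  exec mark_tapes (e, ([::], map inl w) :: nseq 6 ([::], [::]))
    (e, T7 (inz [::] w) (wz [::] [::]) (wz [::] [::]) (wz [::] [::]) (wz [::] [::])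
       (wz [::] [::]) (wz [::] [::])).
Proof. by move=> lB; apply: exec_act => //=; rewrite lB. Qed.

Lemma exec_check_last ok up v e1 e2 e3 e4 z zs :
  exec check_last ((ok, up, v, e1, e2, e3, e4), z :: zs)
    ((ok && e1, up, v, e1, e2, e3, e4), z :: zs).
Proof. exact: exec_act. Qed.

Lemma exec_check_end ok up v e1 e2 e3 e4 zl r zs :
  exec check_end ((ok, up, v, e1, e2, e3, e4), inz zl r :: zs)
    ((ok && nilp r, up, v, e1, e2, e3, e4), inz zl r :: zs).
Proof. by case: r => [|x r]; rewrite ?andbT ?andbF; apply: exec_act. Qed.

(** The meeting point of the two halves of the proof: the output of the machine, described with
    neither machines nor graphs. *)
Definition answer (timed : bool) (w : seq letter) : Prop :=
  exists n mat mb tb, parsed timed w n mat mb tb /\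
    evalq (quantifiers n (size tb)) (leaf_value n (reshape (nseq n n) mat) mb tb).

Lemma exec_read_time timed ok up v e1 e2 e3 e4 zl r n z2 z3 z4 z6 :
  size r < B -> n < B -> exists zl' r' e1' tb ok',
  [/\ exec (read_time timed)
       ((ok, up, v, e1, e2, e3, e4),
        T7 (inz zl r) (wz [::] (nseq n cell0)) z2 z3 z4 (wz [::] [::]) z6)
       ((ok', up, v, e1', e2, e3, e4),
        T7 (inz zl' r') (wz [::] (nseq n cell0)) z2 z3 z4 (wz [::] (map pc tb)) z6),
     size tb <= maxn (size r) n,
     ok' -> [/\ ok, e1, r = (if timed then None :: bits tb else [::]) &
                if timed then is_true (last false tb) else tb = nseq n true] &
     forall tb', ok -> e1 -> r = (if timed then None :: bits tb' else [::]) ->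
       (if timed then is_true (last false tb') else tb' = nseq n true) -> ok' /\ tb = tb'].
Proof.
case: timed => lr ln.
- have [zl1 ex1] := exec_read_hash (ok && e1) up v e1 e2 e3 e4 zl r
    [:: wz [::] (nseq n cell0); z2; z3; z4; wz [::] [::]; z6].
  set r1 := if is_hash r then behead r else r in ex1.
  have szr1 : size r1 <= size r.
    by rewrite /r1; case: ifP => // _; rewrite size_behead leq_pred.
  have [tb [r2 [r1E r2P]]] := split_bits r1.
  have sztb : size tb <= size r.
    by rewrite (leq_trans _ szr1) // r1E size_cat size_map leq_addr.
  have [//|//|//||zl2 ex2] := @exec_read_bits 4 (ok && e1 && is_hash r) up v e1 e2 e3 e4 zl1
    tb r2 [:: wz [::] (nseq n cell0); z2; z3; z4; wz [::] [::]; z6].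
    exact: leq_ltn_trans sztb lr.
  do 5!eexists; split.
  + apply: ExSeq; first exact: exec_check_last.
    apply: (ExSeq ex1); rewrite r1E; apply: (ExSeq ex2).
    apply: ExSeq; first exact: exec_check_last.
    exact: exec_check_end.
  + by rewrite leq_max sztb.
  + case/andP=> /andP[/andP[/andP[okT e1T] rH] lT] /nilP r20.
    split=> //; move: rH r1E; rewrite /r1; case: (r) => [|[] r'] //= _ ->.
    by rewrite r20 cats0.
  + move=> tb' okT e1T rE lT; rewrite okT e1T.
    have /split_bits_inj [] // : map Some tb ++ r2 = map Some tb' ++ [::].
      by rewrite -r1E /r1 rE cats0.
    by rewrite rE /= => -> ->; rewrite lT.
- do 5!eexists; split.
  + apply: ExSeq; first exact: exec_check_last.
    apply: ExSeq; first exact: exec_check_end.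
    rewrite (_ : map pc _ = nseq (size (nseq n cell0)) (pc true)).
      by apply: exec_copy_time; rewrite size_nseq.
    rewrite size_nseq -map_nseq; reflexivity.
  + by rewrite size_nseq leq_max leqnn orbT.
  + by case/andP=> /andP[okT e1T] /nilP.
  + by move=> tb' -> -> -> ->.
Qed.

(** The bound is dictated by the odometer, which has [n + size tb * n.+1] digits with [n] and
    [size tb] at most [size w]. The matrix tape gets at most [n * n] cells, even on malformed
    input. *)
Lemma exec_firefighter timed w : (size w) ^ 2 + 2 * size w < B ->
  exists s, exec (firefighter timed)
    ((true, false, false, false, false, false, false),
     ([::], map inl w) :: nseq 6 ([::], [::])) s /\
    (fval s.1 <-> answer timed w).
Proof.
move=> lB.
have wB : size w < B by apply: leq_ltn_trans lB; rewrite mulSn mul1n addnA addnC leq_addr.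
have [n [r0 [wE r0P]]] := split_ones w.
have nw : n + size r0 = size w by rewrite wE size_cat size_nseq.
have nB : n < B by apply: leq_ltn_trans wB; rewrite -nw leq_addr.
have nnB : n * n < B.
  apply: leq_ltn_trans lB; rewrite (leq_trans _ (leq_addr _ _)) // -mulnn.
  by rewrite leq_mul // -nw leq_addr.
have [zl1 ex1] := exec_read_ones (true, false, false, false, false, false, false)
  [::] (wz [::] [::]) (wz [::] [::]) (wz [::] [::]) (wz [::] [::]) r0P nB.
have [zl2 ex2] := exec_read_hash true false false false false false false zl1 r0
  [:: wz [::] (nseq n cell0); wz [::] (nseq n cell0); wz [::] [::]; wz [::] [::];
      wz [::] [::]; wz [::] [::]].
set r1 := (if is_hash r0 then _ else _) in ex2.
have szr1 : size r1 <= size r0.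
  by rewrite /r1; case: ifP => // _; rewrite size_behead leq_pred.
have nnB' : size (nseq n cell0) * size (nseq n cell0) < B by rewrite size_nseq.
have [zl3 ex3] := exec_read_matrix (is_hash r0) false false false false false false
  zl2 r1 (wz [::] [::]) (wz [::] [::]) (wz [::] [::]) nnB'.
rewrite size_nseq in ex3.
set s3 := iter _ _ _ in ex3.
have szs3 : size s3.2 <= size r0 by apply: leq_trans (size_iter_read_bit _ _) _.
have [zl4 ex4] := exec_read_hash s3.1.1 false false false false false false zl3 s3.2
  [:: wz [::] (nseq n cell0); wz [::] (nseq n cell0); wz [::] (map mc (rev s3.1.2));
      wz [::] [::]; wz [::] [::]; wz [::] [::]].
set r4 := (if is_hash s3.2 then _ else _) in ex4.
have szr4 : size r4 <= size r0.
  apply: leq_trans szs3.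
  by rewrite /r4; case: ifP => // _; rewrite size_behead leq_pred.
have [mb [r5 [r4E r5P]]] := split_bits r4.
have sz5 : size mb + size r5 = size r4 by rewrite r4E size_cat size_map.
have r0w : size r0 <= size w by rewrite -nw leq_addl.
have [//|//|//||zl5 ex5] := @exec_read_bits 3 (s3.1.1 && is_hash s3.2) false false false
  false false false zl4 mb r5
  [:: wz [::] (nseq n cell0); wz [::] (nseq n cell0); wz [::] (map mc (rev s3.1.2));
      wz [::] [::]; wz [::] [::]; wz [::] [::]].
  by apply: leq_ltn_trans wB; apply: leq_trans r0w; apply: leq_trans szr4;
     rewrite -sz5 leq_addr.
have r5B : size r5 < B.
  by apply: leq_ltn_trans wB; apply: leq_trans r0w; apply: leq_trans szr4;
     rewrite -sz5 leq_addl.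
have [zl6 [r6 [e1 [tb [ok [ex6 sztb okP okT]]]]]] := @exec_read_time timed
  (s3.1.1 && is_hash s3.2) false false (last false mb) false false false zl5 r5 n
  (wz [::] (nseq n cell0)) (wz [::] (map mc (rev s3.1.2))) (wz [::] (map pc mb))
  (wz [::] [::]) r5B nB.
have tbw : size tb <= size w.
  rewrite (leq_trans sztb) // geq_max -[X in _ && (n <= X)]nw leq_addr andbT.
  by apply: leq_trans r0w; apply: leq_trans szr4; rewrite -sz5 leq_addl.
have okE : ok -> parsed timed w n (rev s3.1.2) mb tb.
  case/okP=> /andP[/read_bit_ok [r0H [s szs [r1E sE]]] s3H] lmb r5E tbP.
  have matE : rev s3.1.2 = s by rewrite /s3 sE -/(rev s) revK.
  split=> //; last by rewrite matE.
  rewrite wE matE /bits map_nseq; congr (_ ++ _).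
  have hashE (r : seq letter) : is_hash r -> r = None :: behead r by case: r => [|[]].
  have -> : r0 = None :: r1 by rewrite [LHS]hashE // /r1 r0H.
  rewrite r1E; congr (_ :: _ ++ _).
  have -> : s3.2 = None :: r4 by rewrite [LHS]hashE // /r4 s3H.
  by rewrite r4E r5E.
(* Any parse is the one found by the machine, since each block is a maximal run of its kind or, for
   the matrix, has the prescribed length. Hence a cleared flag means that there is no parse. *)
have parsedE n' mat' mb' tb' : parsed timed w n' mat' mb' tb' ->
    [/\ ok, n' = n, mat' = rev s3.1.2, mb' = mb & tb' = tb].
  case=> wE' szmat lmb tbP.
  move: wE'; rewrite wE /bits map_nseq => /split_ones_inj [] // nE r0E; subst n'.
  have s3E : s3 = (true, rev mat', None :: map Some mb' ++
      (if timed then None :: map Some tb' else [::])).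
    by rewrite /s3 /r1 r0E /= -szmat read_bits_cat.
  have [||mbE r5E] := @split_bits_inj mb mb' r5
    (if timed then None :: map Some tb' else [::]) r5P.
  - by case: (timed).
  - by rewrite -r4E /r4 s3E.
  have [||okt tbE] := okT tb' _ _ r5E tbP; rewrite ?s3E ?mbE //.
  by rewrite revK.
(* Reading is a common prefix of the runs on well-formed and malformed words; only the final
   conditional remains. *)
have chain s : exec (If (fun e _ => let: (ok, up, val, e1, e2, e3, e4) := e in ok)
      (build ;; odometer) skip)
    ((ok, false, false, e1, false, false, false),
     T7 (inz zl6 r6) (wz [::] (nseq n cell0)) (wz [::] (nseq n cell0))
       (wz [::] (map mc (rev s3.1.2))) (wz [::] (map pc mb)) (wz [::] (map pc tb))
       (wz [::] [::])) s ->
   exec (firefighter timed)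
    ((true, false, false, false, false, false, false),
     ([::], map inl w) :: nseq 6 ([::], [::])) s.
  move=> exI; apply: ExSeq; first by apply: exec_mark_tapes; apply: leq_ltn_trans nB.
  rewrite wE; apply: (ExSeq ex1); apply: (ExSeq ex2); apply: (ExSeq ex3).
  apply: (ExSeq ex4); rewrite r4E; apply: (ExSeq ex5); exact: (ExSeq ex6).
case: ok okE parsedE chain {okP okT ex6} => okE parsedE chain; last first.
  eexists; split; first by apply: chain; apply: ExIf; exact: exec_act.
  by split=> // -[n' [mat' [mb' [tb' [/parsedE[]]]]]].
have [_ szmat _ _] := okE isT.
set mat := rev s3.1.2 in okE parsedE chain szmat.
pose rows := reshape (nseq n n) mat.
have sumE : sumn (nseq n n) = n * n by rewrite sumn_nseq.
have rowsE : flatten rows = mat by rewrite reshapeKr // sumE szmat.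
have shE : shape rows = nseq n n by rewrite reshapeKl // sumE szmat.
have szr : size rows = n by rewrite -(size_map size) -/(shape rows) shE size_nseq.
have szrows : all (fun ms => size ms == n) rows.
  by rewrite -(all_map size (pred1 n)) -/(shape rows) shE all_pred1_nseq.
have [s [exO vE]] := exec_odometer mb tb szr szrows false e1 false false false
  (inz zl6 r6) (size_nseq n cell0) (size_nseq n cell0).
exists s; split.
  apply: chain; apply: ExIf => /=; rewrite -rowsE.
  apply: ExSeq exO.
  have := @exec_build (true, false, false, e1, false, false, false) (inz zl6 r6)
    (wz [::] (nseq n cell0)) (nseq n cell0) (wz [::] (map mc (flatten rows)))
    (wz [::] (map pc mb)) (map pc tb).
  rewrite !size_nseq size_map; apply; apply: leq_ltn_trans lB.
  have nw' : n <= size w by rewrite -nw leq_addr.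
  by rewrite mulnS addnA addnC -mulnn mul2n -addnn leq_add ?leq_mul ?leq_add.
rewrite vE; split=> [ev|[n' [mat' [mb' [tb' [/parsedE[_ -> -> -> ->]]]]]] //].
by exists n, mat, mb, tb; split=> //; apply: okE.
Qed.

End Exec.

(** * The quantified formula *)

Definition bits_value (bs : seq bool) : nat := foldr (fun (b : bool) n => b + n.*2) 0 bs.

Lemma positive_bits_value p : bits_value (positive_bits p) = nat_of_pos p.
Proof. by elim: p => //= p ->; rewrite ?NatTrec.doubleE. Qed.

Lemma last_positive_bits p b : last b (positive_bits p).
Proof. by elim: p b => /=. Qed.

Lemma binary_value n : bits_value (binary n) = n.
Proof.
rewrite -[RHS]bin_of_natK /binary; case: (bin_of_nat n) => //= p.
exact: positive_bits_value.
Qed.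

Lemma last_binary n : 0 < n -> last false (binary n).
Proof.
rewrite -{1}[n]binary_value /binary; case: (bin_of_nat n) => //= p _.
exact: last_positive_bits.
Qed.

Lemma positive_bits_surj bs : last false bs -> exists p, positive_bits p = bs.
Proof.
elim: bs => [|b [|c bs] IH] //=; first by case: b => // _; exists BinNums.xH.
move=> lbs; have [p pE] := IH lbs.
by case: b; [exists (BinNums.xI p) | exists (BinNums.xO p)]; rewrite /= pE.
Qed.

Lemma binaryK bs : last false bs -> binary (bits_value bs) = bs.
Proof.
case/positive_bits_surj=> p <-; rewrite positive_bits_value /binary.
by rewrite -[nat_of_pos p]/(nat_of_bin (BinNums.Npos p)) nat_of_binK.
Qed.

Lemma bits_value_gt0 bs : last false bs -> 0 < bits_value bs.
Proof.
elim: bs => [|[] [|c bs] IH] //= lbs.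
by rewrite add0n double_gt0 IH.
Qed.

Lemma bits_value_ones n : (bits_value (nseq n true)).+1 = 2 ^ n.
Proof. by elim: n => //= n IH; rewrite expnS mul2n -IH doubleS. Qed.

(** * Meaning of quantifier blocks and of the counter *)

Lemma evalq_cat ks1 ks2 f :
  evalq (ks1 ++ ks2) f = evalq ks1 (fun s1 => evalq ks2 (fun s2 => f (s1 ++ s2))).
Proof.
elim: ks1 f => [|k ks1 IH] f //=.
by rewrite !(IH (fun s => f (_ :: s))).
Qed.

Lemma evalq_forall n f :
  evalq (nseq n true) f <-> forall s, size s = n -> f s.
Proof.
elim: n f => [|n IH] f /=.
  by split=> [fT s /size0nil-> //|]; apply.
split.
  case/andP=> /andP[/andP[]] /IH h00 /IH h01 /IH h10 /IH h11 [|[[] []] s] //= [szs].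
  - exact: h11.
  - exact: h10.
  - exact: h01.
  - exact: h00.
by move=> h; apply/andP; split; [apply/andP; split; [apply/andP; split|]|];
  apply/IH => s szs; apply: h; rewrite /= szs.
Qed.

Lemma evalq_exists n f :
  evalq (nseq n false) f <-> exists2 s, size s = n & f s.
Proof.
elim: n f => [|n IH] f /=.
  by split=> [fT|[s /size0nil->]] //; exists [::].
split.
  by case/orP=> [/orP[/orP[]|]|] /IH[s szs fs];
    [exists ((false, false) :: s) | exists ((false, true) :: s)
    |exists ((true, false) :: s) | exists ((true, true) :: s)]; rewrite //= szs.
case=> -[|[[] []] s] //= [szs] fs; apply/orP.
- by right; apply/IH; exists s.
- by left; apply/orP; right; apply/IH; exists s.
- by left; apply/orP; left; apply/orP; right; apply/IH; exists s.
- by left; apply/orP; left; apply/orP; left; apply/IH; exists s.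
Qed.

Definition pcur (p : cell) : bool := let: (_, c, _, _) := p in c.

Lemma pdecP ps : (pdec ps).1 = (0 < bits_value (map pcur ps)) /\
  ((pdec ps).1 -> (bits_value (map pcur (pdec ps).2)).+1 = bits_value (map pcur ps)).
Proof.
elim: ps => [|[[[m []] x] y] ps [IH1 IH2]] //=.
rewrite !add0n IH1 double_gt0; split=> // pos.
by rewrite -IH2 ?IH1 // doubleS add1n.
Qed.

(** Once the counter underflows the verdict stays false, whatever the wrapped-around bits would
    allow afterwards. *)
Lemma pdecsP ps fs : (pdecs ps fs).1 = (count id fs <= bits_value (map pcur ps)).
Proof.
elim: fs ps => [|[] fs IH] ps //=.
have [E1 E2] := pdecP ps; rewrite IH.
case: (pdec ps) E1 E2 => -[] q /= E1 E2; last first.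
  by case: (bits_value (map pcur ps)) E1.
by rewrite -E2 // add1n ltnS.
Qed.

(** * Reachability and symmetry as quantified formulas *)

Section Relation.
Variables (V : finType) (e : rel V).
Implicit Types (A B C F : {set V}) (v : V -> cell).

(** A burning step along an arbitrary relation, because the matrix is not known to be symmetric
    while the formula is evaluated. *)
Definition estep A F : {set V} :=
  [set y | (y \in A :\: F) || [exists x in A :\: F, e x y]].

Lemma estepS A B F : A \subset B -> estep A F \subset estep B F.
Proof.
move=> sAB; have sD : A :\: F \subset B :\: F by apply: setSD.
apply/subsetP=> y; rewrite inE => /orP[yA|/exists_inP[x xA exy]].
  by rewrite inE (subsetP sD).
by rewrite inE; apply/orP; right; apply/exists_inP; exists x => //; apply: (subsetP sD).
Qed.

Lemma foldl_estepS A B Fs : A \subset B -> foldl estep A Fs \subset foldl estep B Fs.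
Proof. by elim: Fs A B => //= F Fs IH A B /(estepS F)/IH. Qed.

Definition reach (m T : nat) A B : Prop := exists Fs,
  [/\ size Fs = T, all (fun F : {set V} => #|F| <= m) Fs & foldl estep A Fs \subset B].

Lemma reach0 m A B : reach m 0 A B <-> A \subset B.
Proof. by split=> [[Fs [/size0nil-> _]]|sAB] //; exists [::]. Qed.

Lemma reachS m T A B :
  reach m T.+1 A B <-> exists2 F : {set V}, #|F| <= m & reach m T (estep A F) B.
Proof.
split=> [[[|F Fs] [//= [szF] /andP[leF allF] sub]]|[F leF [Fs [szF allF sub]]]].
  by exists F => //; exists Fs.
by exists (F :: Fs); rewrite /= szF leF.
Qed.

(** From right to left this is monotonicity: a play that works from [C] also works from the subset
    of [C] actually reached. *)
Lemma reachD m T1 T2 A B :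
  reach m (T1 + T2) A B <-> exists2 C, reach m T1 A C & reach m T2 C B.
Proof.
split=> [[Fs [szF allF sub]]|[C [Fs1 [sz1 all1 sub1]] [Fs2 [sz2 all2 sub2]]]].
  move: szF allF sub; rewrite -[Fs](cat_take_drop T1) all_cat foldl_cat.
  move=> szF /andP[all1 all2] sub.
  have leT1 : T1 <= size Fs by rewrite -[Fs](cat_take_drop T1) szF leq_addr.
  have sz1 : size (take T1 Fs) = T1 by rewrite size_take_min; apply/minn_idPl.
  exists (foldl estep A (take T1 Fs)); first by exists (take T1 Fs).
  by exists (drop T1 Fs); split=> //; move: szF; rewrite size_cat sz1 => /addnI.
exists (Fs1 ++ Fs2); rewrite size_cat all_cat foldl_cat sz1 sz2 all1; split=> //.
exact: subset_trans (foldl_estepS _ sub1) sub2.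
Qed.

Local Notation X := (enum V).
Definition erows (S : seq V) : seq (seq bool) := [seq [seq e x y | y <- X] | x <- S].

(** Turns a block of digits, one per vertex, into functions on [V] and thereby into sets. *)
Lemma seq_of_fun (T : Type) (t0 : T) (s : seq T) : size s = #|V| ->
  exists f : V -> T, s = map f X.
Proof.
move=> szs; exists (fun x => nth t0 s (index x X)).
have szX : size X = size s by rewrite -cardE.
apply: (@eq_from_nth _ t0); first by rewrite size_map szX.
move=> i lti; have [x0 _] : exists x0 : V, true.
  case: X szX => [|x ?] szX; last by exists x.
  by rewrite -szX in lti.
by rewrite (nth_map x0) ?szX // index_uniq ?enum_uniq ?szX.
Qed.

Lemma nrow_gstep t u (w : V -> bool) v (Y : seq V) :
  nrow (gstep t) u tt (map w Y) (map v Y) =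
  (tt, [seq (gstep t tt u (w y) (v y)).2 | y <- Y]).
Proof.
elim: Y => //= y Y IH.
by case: (u) IH => [[[? ?] ?] ?]; case: (v y) => [[[? ?] ?] ?] /= ->.
Qed.

(** The list [S] of rows is arbitrary so that the induction can remove rows while the columns keep
    ranging over all of [V]. *)
Lemma nrows_gstep t (a b c d ux u2 u3 u4 : V -> bool) (S : seq V) :
  (nrows (gstep t) [seq (ux x, u2 x, u3 x, u4 x) | x <- S] (erows S) tt
     [seq (a y, b y, c y, d y) | y <- X]).2 =
  [seq (a y || t && has (fun x => ux x && e x y) S, b y, c y, d y) | y <- X].
Proof.
elim: S a => [|x S IH] a /=; first by apply: eq_map => y; rewrite andbF orbF.
rewrite nrow_gstep IH; apply: eq_map => y /=; congr (_, _, _, _).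
by case: (t) => //=; rewrite ?orbF // orbA.
Qed.

Lemma load_u_map (a b c d : V -> bool) (f g : V -> bool) (Y : seq V) :
  load_u [seq (a x, b x, c x, d x) | x <- Y] [seq (f x, g x) | x <- Y] =
  [seq (a x && ~~ f x, false, false, false) | x <- Y].
Proof. by elim: Y => //= x Y ->. Qed.

Lemma load_v_map t (a b c d : V -> bool) (f g : V -> bool) (Y : seq V) :
  load_v t [seq (a x, b x, c x, d x) | x <- Y] [seq (f x, g x) | x <- Y] =
  [seq (if t then a x && ~~ f x else a x, b x, g x, false) | x <- Y].
Proof. by elim: Y => //= x Y ->. Qed.

Lemma level_v_map t ch A B F C (c d : V -> bool) :
  level_v t ch (erows X) [seq (x \in A, x \in B, c x, d x) | x <- X]
    [seq (x \in F, x \in C) | x <- X] =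
  [seq (x \in (if ch then C else if t then estep A F else A),
        x \in (if ch then B else C), x \in C, false) | x <- X].
Proof.
rewrite /level_v load_u_map load_v_map.
rewrite (nrows_gstep t (fun x => if t then (x \in A) && (x \notin F) else x \in A)
  (fun x => x \in B) (fun x => x \in C) (fun=> false)
  (fun x => (x \in A) && (x \notin F)) (fun=> false) (fun=> false) (fun=> false)).
rewrite -map_comp; apply: eq_map => x /=; case: ch => //; congr (_, _, _, _).
case: t; rewrite ?orbF //= !inE andbC; congr (_ || _).
apply/hasP/exists_inP => [[y _ /andP[yA exy]]|[y yA exy]].
  by exists y; rewrite // inE andbC.
by exists y; rewrite ?mem_enum // exy andbT andbC -in_setD.
Qed.

Lemma pdecs_map mb t F (C : V -> bool) :
  (pdecs (map pc mb) [seq t && d.1 | d <- [seq (x \in F, C x) | x <- X]]).1 =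
  t ==> (#|F| <= bits_value mb).
Proof.
rewrite pdecsP (_ : map pcur _ = mb); last by rewrite -map_comp map_id.
rewrite (_ : count _ _ = if t then #|F| else 0); first by case: t.
rewrite -map_comp count_map; case: t => /=; last first.
  by rewrite (eq_count (a2 := pred0)) ?count_pred0.
by rewrite cardE -size_filter enumT; congr size; rewrite /enum_mem; apply: eq_filter.
Qed.

(** Induction on the bits of the time bound. The flag [v] collects the cardinality tests of the
    outer levels; [c] and [d] are whatever the previous level left in the cells, overwritten by the
    next one. *)
Lemma evalq_levels mb tb (v : bool) A B (c d : V -> bool) :
  evalq (flatten (nseq (size tb) (rcons (nseq #|V| false) true)))
    (fun s => let r := levels (erows X) mb tb v
                [seq (x \in A, x \in B, c x, d x) | x <- X] s in
              r.1 && all sub_ab r.2) <->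
  v /\ reach (bits_value mb) (bits_value tb) A B.
Proof.
elim: tb v A B c d => [|t tb IH] v A B c d.
  rewrite /= reach0; split=> [/andP[-> /allP sub]|[-> /subsetP sub]]; [split=> //|].
    apply/subsetP=> x xA; have /= := sub (x \in A, x \in B, c x, d x).
    by rewrite xA; apply; apply/mapP; exists x; rewrite ?mem_enum // xA.
  by rewrite all_map; apply/allP=> x _ /=; apply/implyP/sub.
have stepE s (b b' : bool) s' : size s = #|V| ->
   let r := levels (erows X) mb (t :: tb) v
                [seq (x \in A, x \in B, c x, d x) | x <- X] (s ++ (b, b') :: s') in
   r = levels (erows X) mb tb (v && (pdecs (map pc mb) [seq t && d.1 | d <- s]).1)
     (level_v t b (erows X) [seq (x \in A, x \in B, c x, d x) | x <- X] s) s'.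
  move=> szs /=; rewrite size_map -cardE -szs take_size_cat // nth_cat ltnn subnn /=.
  by rewrite -addn1 addnC -drop_drop drop_size_cat //= drop0.
rewrite [size (_ :: _)]/= [nseq _.+1 _]/= [flatten (_ :: _)]/=.
rewrite evalq_cat -{1}cats1 evalq_cat evalq_exists.
(* The time is [t] plus twice the remaining value: an optional single step with [F], then two equal
   halves that meet in [C]. *)
have reachE : reach (bits_value mb) (bits_value (t :: tb)) A B <->
    exists (F C : {set V}), [/\ t ==> (#|F| <= bits_value mb),
      reach (bits_value mb) (bits_value tb) (if t then estep A F else A) C &
      reach (bits_value mb) (bits_value tb) C B].
  rewrite /= -addnn; case: t {stepE}; rewrite ?add1n ?add0n.
    rewrite reachS; split=> [[F leF /reachD[C]]|[F [C [leF r1 r2]]]].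
      by exists F, C.
    by exists F => //; apply/reachD; exists C.
  (* For a zero bit [F] is unconstrained; [set0] serves as witness. *)
  rewrite reachD; split=> [[C]|[_ [C [_ r1 r2]]]]; first by exists set0, C.
  by exists C.
split=> [[s szs ev]|[vT /reachE[F [C [leF r1 r2]]]]].
  have [fc sE] := seq_of_fun (false, false) szs.
  pose F := [set x | (fc x).1]; pose C := [set x | (fc x).2].
  have {}sE : s = [seq (x \in F, x \in C) | x <- X].
    by rewrite sE; apply: eq_map => x; rewrite !inE; case: (fc x).
  have evb b : v && (t ==> (#|F| <= bits_value mb)) /\
     reach (bits_value mb) (bits_value tb)
       (if b then C else if t then estep A F else A) (if b then B else C).
    apply/(IH _ _ _ (fun x => x \in C) (fun=> false)).
    rewrite -(pdecs_map mb t F (fun x => x \in C)) -(level_v_map _ _ _ _ _ _ c d) -sE.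
    (* The choice digit is a universal block of length one; its first bit is set to the wanted half
       [b]. *)
    have := (evalq_forall 1 _).1 ev [:: (b, false)] erefl.
    rewrite (@eq_evalq _ _ (fun s' => let r := levels (erows X) mb tb
       (v && (pdecs (map pc mb) [seq t && d.1 | d <- s]).1)
       (level_v t b (erows X) [seq (x \in A, x \in B, c x, d x) | x <- X] s) s' in
       r.1 && all sub_ab r.2)) //.
    by move=> s'; cbv beta; rewrite -catA [_ ++ s']/= stepE.
  have [/andP[vT leF] r1] := evb false; have [_ r2] := evb true.
  by split=> //; apply/reachE; exists F, C.
exists [seq (x \in F, x \in C) | x <- X]; first by rewrite size_map -cardE.
apply/(evalq_forall 1) => -[|[b b'] [|]] // _.
rewrite (@eq_evalq _ _ (fun s' => let r := levels (erows X) mb tb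
  (v && (pdecs (map pc mb)
           [seq t && d.1 | d <- [seq (x \in F, x \in C) | x <- X]]).1)
  (level_v t b (erows X) [seq (x \in A, x \in B, c x, d x) | x <- X]
     [seq (x \in F, x \in C) | x <- X]) s' in r.1 && all sub_ab r.2)); last first.
  by move=> s'; cbv beta; rewrite -catA [_ ++ s']/= stepE // size_map -cardE.
rewrite pdecs_map level_v_map vT leF.
by apply/(IH _ _ _ (fun x => x \in C) (fun=> false)); split=> //; case: b.
Qed.

Lemma nrow_gcheck (s : bool * bool * bool) (ux uy u3 u4 : bool) (w vx vy v3 v4 : V -> bool)
    (Y : seq V) :
  nrow gcheck (ux, uy, u3, u4) s (map w Y) [seq (vx y, vy y, v3 y, v4 y) | y <- Y] =
  ((s.1.1 || has (fun y => [&& ux, w y & vy y]) Y,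
    s.1.2 || has (fun y => [&& uy, w y & vx y]) Y,
    s.2 || has (fun y => [&& ux, w y & vx y]) Y),
   [seq (vx y, vy y, v3 y, v4 y) | y <- Y]).
Proof.
elim: Y s => [|y Y IH] [[e1 e2] e3] /=; first by rewrite !orbF.
by rewrite IH /= !orbA.
Qed.

Lemma nrows_gcheck (s : bool * bool * bool) (ux uy u3 u4 vx vy v3 v4 : V -> bool)
    (S : seq V) :
  nrows gcheck [seq (ux x, uy x, u3 x, u4 x) | x <- S] (erows S) s
    [seq (vx y, vy y, v3 y, v4 y) | y <- X] =
  ((s.1.1 || has (fun x => has (fun y => [&& ux x, e x y & vy y]) X) S,
    s.1.2 || has (fun x => has (fun y => [&& uy x, e x y & vx y]) X) S,
    s.2 || has (fun x => has (fun y => [&& ux x, e x y & vx y]) X) S),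
   [seq (vx y, vy y, v3 y, v4 y) | y <- X]).
Proof.
elim: S s => [|x S IH] [[e1 e2] e3] /=; first by rewrite !orbF.
by rewrite nrow_gcheck IH /= !orbA.
Qed.

Lemma sym_checkE (s : seq (bool * bool)) (k : V -> bool * bool) :
  keep_first false s = map k X ->
  sym_check (erows X) s =
  ([exists x, exists y, [&& (k x).1, e x y & (k y).2]] ==
   [exists x, exists y, [&& (k x).2, e x y & (k y).1]]) &&
  ~~ [exists x, exists y, [&& (k x).1, e x y & (k y).1]].
Proof.
move=> kE; rewrite /sym_check kE -map_comp.
rewrite (nrows_gcheck _ (fun x => (k x).1) (fun x => (k x).2) (fun=> false)
  (fun=> false) (fun x => (k x).1) (fun x => (k x).2) (fun=> false) (fun=> false)) /=.
have hasE (p : V -> V -> bool) :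
    has (fun x => has (p x) X) X = [exists x, exists y, p x y].
  apply/hasP/existsP => [[x _ /hasP[y _ pxy]]|[x /existsP[y pxy]]].
    by exists x; apply/existsP; exists y.
  by exists x; rewrite ?mem_enum //; apply/hasP; exists y; rewrite ?mem_enum.
by rewrite !hasE.
Qed.

Lemma count_keep_first b s : count (fun d => d.1) (keep_first b s) <= ~~ b.
Proof.
elim: s b => [|[x y] s IH] b //=.
by case: x b (IH (b || x)) => [] [] //=; rewrite ?orbT ?leqn0 => // /eqP->.
Qed.

(** Truncation leaves a singleton X unchanged, which keeps all pairs of singletons available as
    tests. *)
Lemma keep_first_singleton (Y : seq V) (x0 : V) (g : V -> bool) (b : bool) :
  uniq Y -> (b -> x0 \notin Y) ->
  keep_first b [seq (x == x0, g x) | x <- Y] = [seq (x == x0, g x) | x <- Y].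
Proof.
elim: Y b => //= y Y IH b /andP[yY uY] bY.
rewrite IH //.
  congr ((_, _) :: _); case: eqP => // yx; case: b bY => // /(_ isT).
  by rewrite yx inE eqxx.
case: eqP => [<- //|_]; rewrite orbF => /bY; rewrite inE negb_or.
by case/andP.
Qed.

(** At the singletons of [x] and [y] the test reads [e x y = e y x] and excludes a loop at [x].
    Conversely, symmetry exchanges the two forms, and an edge from the truncated X to itself would
    be a loop, X having at most one element. *)
Lemma sym_check_all :
  (forall s, size s = #|V| -> sym_check (erows X) s) <-> symmetric e /\ irreflexive e.
Proof.
split=> [chk|[esym eirr] s szs].
  have chk2 x y : (e x y == e y x) && ~~ e x x.
    have := chk [seq (z == x, z == y) | z <- X]; rewrite size_map -cardE => /(_ erefl).
    rewrite (sym_checkE (k := fun z => (z == x, z == y))) /=; last first.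
      exact: keep_first_singleton (enum_uniq V) _.
    have exE x' y' : [exists z, exists t, [&& z == x', e z t & t == y']] = e x' y'.
      apply/existsP/idP => [[z /existsP[t /and3P[/eqP<- ? /eqP<-]]] //|exy].
      by exists x'; apply/existsP; exists y'; rewrite !eqxx exy.
    by rewrite !exE.
  by split=> [x y|x]; [have /andP[/eqP] := chk2 x y | have /andP[_ /negPf] := chk2 x x].
have [k kE] := seq_of_fun (false, false) (etrans (size_keep_first false s) szs).
rewrite (sym_checkE kE); apply/andP; split.
  apply/eqP; apply/existsP/existsP => -[x /existsP[y /and3P[kx exy ky]]];
    by exists y; apply/existsP; exists x; rewrite kx ky esym exy.
apply/existsP=> -[x /existsP[y /and3P[kx exy ky]]].
have : #|[pred z | (k z).1]| <= 1.
  have := count_keep_first false s; rewrite kE count_map -size_filter.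
  by rewrite cardE enumT.
by move/card_le1_eqP=> /(_ x y); rewrite !inE => /(_ kx ky) xy; rewrite xy eirr in exy.
Qed.

Lemma evalq_leaf mb tb :
  evalq (quantifiers #|V| (size tb)) (leaf_value #|V| (erows X) mb tb) <->
  [/\ symmetric e, irreflexive e &
      reach (bits_value mb) (bits_value tb) setT set0].
Proof.
rewrite /quantifiers evalq_cat evalq_forall.
have leafE s : size s = #|V| ->
  evalq (flatten (nseq (size tb) (rcons (nseq #|V| false) true)))
    (fun s2 => leaf_value #|V| (erows X) mb tb (s ++ s2)) <->
  sym_check (erows X) s /\ reach (bits_value mb) (bits_value tb) setT set0.
  move=> szs; rewrite -(evalq_levels mb tb _ setT set0 (fun=> false) (fun=> false)).
  set r := evalq _ _; set r' := evalq _ _; suff -> : r = r' by [].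
  apply: eq_evalq => s2; rewrite /leaf_value take_size_cat // drop_size_cat //.
  suff -> : nseq #|V| ab_init = [seq (x \in setT, x \in set0, false, false) | x <- X].
    by [].
  rewrite (eq_map (g := fun=> ab_init)); last by move=> x; rewrite !inE.
  by rewrite cardE; elim: X => //= x Y ->.
split=> [h|[esym eirr r] s szs].
  have [|esym eirr] := sym_check_all.1; first by move=> s szs; case/leafE: (h s szs).
  (* Reachability does not depend on X and Y, so any assignment to them extracts it; here the
     all-false one. *)
  by split=> //; case/leafE: (h _ (size_nseq #|V| (false, false))) => //; rewrite size_nseq.
by apply/leafE => //; split=> //; apply: sym_check_all.2.
Qed.

End Relation.

(** * Graphs and encodings *)

Lemma estep_adj (G : sgraph) (A F : {set G}) :
  estep (@adj G) A F = let U := A :\: F in U :|: nbhd U.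
Proof.
apply/setP=> y; rewrite /= in_set in_setU; case yU: (y \in A :\: F) => //=.
by rewrite inE yU.
Qed.

Lemma burning_foldl (G : sgraph) (Fs : seq {set G}) t : t <= size Fs ->
  burning Fs t = foldl (estep (@adj G)) setT (take t Fs).
Proof.
elim: t => [|t IH] lt; first by rewrite take0.
by rewrite (take_nth set0) // foldl_rcons /= -IH ?estep_adj // ltnW.
Qed.

Lemma winnable_reach (G : sgraph) m T :
  winnable_in_time G m T <-> reach (@adj G) m T setT set0.
Proof.
split=> [[Fs [[szF allF]]]|[Fs [szF allF]]].
  rewrite /winning burning_foldl // take_size => E.
  by exists Fs; rewrite E.
rewrite subset0 => /eqP E; exists Fs; split=> //.
by rewrite /winning burning_foldl // take_size.
Qed.

Lemma estep_set0 (V : finType) (e : rel V) F : estep e set0 F = set0.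
Proof.
apply/setP=> y; rewrite !inE andbF /=; apply/existsP=> -[x].
by rewrite !inE andbF.
Qed.

(** [reach] fixes the exact length; since the empty set stays empty, a play can be padded with empty
    moves. *)
Lemma reach_set0 (V : finType) (e : rel V) m T A : reach e m T A set0 ->
  forall T', T <= T' -> reach e m T' A set0.
Proof.
move=> r T' /subnKC<-; apply/reachD; exists set0 => //.
exists (nseq (T' - T) set0); rewrite size_nseq all_nseq cards0 orbT; split=> //.
by elim: (T' - T) => //= k; rewrite estep_set0.
Qed.

(* A shortest play visits each of the [2 ^ #|V|] sets at most once. *)
Lemma reach_short (V : finType) (e : rel V) m T A : reach e m T A set0 ->
  reach e m (2 ^ #|V|).-1 A set0.
Proof.
case=> Fs [_ allF sub].
pose R (X Y : {set V}) := [exists F : {set V}, (#|F| <= m) && (Y == estep e X F)].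
have pathR X p : path R X p ->
    exists Gs, [/\ size Gs = size p, all (fun F : {set V} => #|F| <= m) Gs &
                   foldl (estep e) X Gs = last X p].
  elim: p X => [|Y p IH] X /=; first by exists [::].
  case/andP=> /existsP[F /andP[leF /eqP->]] /IH[Gs [szG allG E]].
  by exists (F :: Gs); rewrite /= szG leF.
have : connect R A set0.
  have <- : foldl (estep e) A Fs = set0 by apply/eqP; rewrite -subset0.
  elim: Fs A allF {sub} => [|F Fs IH] A /=; first by rewrite connect0.
  case/andP=> leF /IH c; apply: connect_trans (c _); apply: connect1.
  by apply/existsP; exists F; rewrite leF eqxx.
case/connectP=> p0 /shortenP[p pth up _ lastE].
have [Gs [szG allG E]] := pathR _ _ pth.
(* The list [p] omits the start [A], so at most [2 ^ #|V|] distinct sets give at most [2 ^ #|V| - 1]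
   steps, the value of a string of [#|V|] ones. *)
apply: (@reach_set0 _ _ _ (size p)); first by exists Gs; rewrite E -lastE.
have /card_uniqP := up; rewrite /= => szp.
rewrite -ltnS prednK ?expn_gt0 // -szp (leq_trans (max_card _)) //.
by rewrite -cardsT -powersetT card_powerset cardsT.
Qed.

Lemma ffn_le (G : sgraph) m : 0 < m ->
  ffn G <= m <-> reach (@adj G) m (2 ^ #|G|).-1 setT set0.
Proof.
move=> m_gt0; rewrite -winnable_reach; split=> [|w]; last first.
  rewrite /ffn; case: ex_minnP => k _; apply; rewrite m_gt0.
  by apply/boolp.asboolP; exists (2 ^ #|G|).-1.
rewrite /ffn; case: ex_minnP => k /andP[_ /boolp.asboolP[T]] + _ km.
move/winnable_reach/reach_short => [Fs [szF allF sub]]; apply/winnable_reach.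
exists Fs; split=> //; apply: sub_all allF => F leF; exact: leq_trans leF km.
Qed.

(** The truth of the formula supplies the two proofs needed to make the matrix an [sgraph] on
    ['I_n]. Conversely, a graph on any vertex type is read in the order of its [enum]. *)
Lemma answer_graph timed w : answer timed w <->
  exists (G : sgraph) (mb tb : seq bool),
    [/\ last false mb,
        if timed then is_true (last false tb) else tb = nseq #|G| true,
        w = encode_graph G ++ None :: bits mb
            ++ (if timed then None :: bits tb else [::]) &
        reach (@adj G) (bits_value mb) (bits_value tb) setT set0].
Proof.
have rowsE (V : finType) (e : rel V) :
    reshape (nseq #|V| #|V|) [seq e x y | x <- enum V, y <- enum V] = erows e (enum V).
  rewrite -[RHS]flattenK; congr reshape.
  rewrite /shape -map_comp (eq_map (g := fun=> #|V|)).
    by rewrite [in nseq #|V|]cardE; elim: (enum V) => //= x Y ->.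
  by move=> x /=; rewrite size_map -cardE.
split=> [[n [mat [mb [tb [[wE szm lmb tbP] ev]]]]]|[G [mb [tb [lmb tbP wE r]]]]].
  pose rows := reshape (nseq n n) mat.
  have sumE : sumn (nseq n n) = size mat by rewrite sumn_nseq szm.
  have shE : shape rows = nseq n n by rewrite reshapeKl // sumE.
  have szr : size rows = n by rewrite -(size_map size) -/(shape rows) shE size_nseq.
  pose e : rel 'I_n := fun i j => nth false (nth [::] rows i) j.
  have enumE (T : Type) (x0 : T) (l : seq T) :
      size l = n -> [seq nth x0 l (val i) | i <- enum 'I_n] = l.
    by move=> szl; rewrite (map_comp (nth x0 l) val) val_enum_ord -szl map_nth_iota0 ?take_size.
  have matE : mat = [seq e x y | x <- enum 'I_n, y <- enum 'I_n].
    rewrite -[LHS](reshapeKr (sh := nseq n n)) ?sumE // -/rows -[in LHS](enumE _ [::] rows szr).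
    congr flatten; apply: eq_map => i; rewrite enumE //.
    by rewrite -(nth_map _ 0) ?szr // -/(shape rows) shE nth_nseq ltn_ord.
  have [|esym eirr r] := (evalq_leaf e mb tb).1.
    by rewrite -rowsE -matE card_ord.
  exists (SGraph esym eirr), mb, tb; rewrite /= card_ord; split=> //.
  by rewrite /encode_graph /= card_ord -matE -!catA.
exists #|G|, [seq adj x y | x <- enum G, y <- enum G], mb, tb; split.
  split=> //; first by rewrite wE /encode_graph -!catA.
  by rewrite size_allpairs -cardE.
rewrite rowsE; apply/evalq_leaf; split=> //; [exact: adj_sym | exact: adj_irr].
Qed.

Lemma answer_timed w : answer true w <-> FireFightingInTime w.
Proof.
rewrite answer_graph; split=> [[G [mb [tb [lmb ltb wE r]]]]|[G [m [T [m0 T0 wE r]]]]].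
  exists G, (bits_value mb), (bits_value tb).
  by rewrite !bits_value_gt0 // !binaryK //; split=> //; apply/winnable_reach.
exists G, (binary m), (binary T); rewrite !last_binary // !binary_value; split=> //.
exact/winnable_reach.
Qed.

Lemma answer_untimed w : answer false w <-> FireFighting w.
Proof.
have onesE n : bits_value (nseq n true) = (2 ^ n).-1 by rewrite -bits_value_ones.
rewrite answer_graph; split=> [[G [mb [tb [lmb -> wE r]]]]|[G [m [m0 wE r]]]].
  exists G, (bits_value mb); rewrite bits_value_gt0 // binaryK //; split=> //.
    by rewrite wE cats0.
  by apply/ffn_le; rewrite ?bits_value_gt0 // -onesE.
exists G, (binary m), (nseq #|G| true).
rewrite last_binary // binary_value cats0 onesE; split=> //.
exact/ffn_le.
Qed.

Lemma firefighter_PSPACE timed (L : seq letter -> Prop) :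
  (forall w, answer timed w <-> L w) -> PSPACE L.
Proof.
move=> answerL.
apply: (@compiled_PSPACE letter (option cell) flags 6 (firefighter timed)
  (true, false, false, false, false, false, false) fval L
  (fun n => (n ^ 2 + 2 * n).+1) 28 2).
- by move=> n; rewrite ltnW // ltnS mulSn mul1n addnA addnC leq_addr.
(* Seven tapes of at most [n ^ 2 + 2 * n + 2] cells each, which is at most [4 * n ^ 2 + 4] because
   [2 * n <= n ^ 2 + 1]. *)
- move=> n; rewrite -[28]/(7 * 4) -mulnA -mulnDr leq_mul2l /=.
  have [le _] := nat_Cauchy n 1; rewrite muln1 exp1n in le.
  apply: (@leq_trans (n ^ 2 + (n ^ 2 + 1)).+2); first by rewrite !ltnS leq_add2l.
  have -> : (n ^ 2 + (n ^ 2 + 1)).+2 = 2 * n ^ 2 + 3.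
    by rewrite addnA addnn -mul2n addn1 addn3.
  have -> : 4 * n ^ 2 + 4 = 2 * n ^ 2 + 3 + (2 * n ^ 2).+1.
    by rewrite -[4 in LHS]/(2 + 2) mulnDl -addnA addnCA addn3 !addnS !addSn addn0.
  exact: leq_addr.
move=> w; have [s [ex vE]] := exec_firefighter timed (ltnSn (size w ^ 2 + 2 * size w)).
by exists s; split=> //; rewrite vE.
Qed.

Theorem theorem8 : PSPACE FireFightingInTime /\ PSPACE FireFighting.
Proof.
by split; [apply: firefighter_PSPACE answer_timed | apply: firefighter_PSPACE answer_untimed].
Qed.
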